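(* Let $\mathsf{M}\in\mathbb{N}\setminus\{1\}$, $r\in\mathbb{N}$ and $p\in[1,\infty]$. Let $a\in(l_0(\mathbb{Z}^d))^{r\times r}$ be such that $\mathrm{sr}(a,\mathsf{M}I_d)=m_a$. Suppose $k_0\in\mathbb{N}_0$ satisfies $\mathrm{sm}_p(a,\mathsf{M}I_d)\le k_0\le m_a$ and $\upsilon\in(l_0(\mathbb{Z}^d))^{1\times r}$ is an order $k_0$ matching filter of $a$, i.e. $$\widehat{\upsilon}(0)\ne0,\qquad \widehat{\upsilon}(\mathsf{M}\xi)\widehat{a}(\xi+2\pi\omega)=\boldsymbol{\delta}(\omega)\widehat{\upsilon}(\xi)+O(\|\xi\|^{k_0}),\quad \xi\to0,\quad\forall\,\omega\in\Omega_{\mathsf{M}I_d}.$$ Then $$\rho(a,\mathsf{M}I_d)_p=\rho_{k_0}(a,\mathsf{M}I_d,\upsilon)_p .$$ Consequently, $$\mathrm{sm}_p(a,\mathsf{M}I_d)=\frac dp-\log_{\mathsf{M}}\rho_{k_0}(a,\mathsf{M}I_d,\upsilon)_p .$$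
   Context: Notation. $(l_0(\mathbb{Z}^d))^{r\times s}$ is the space of finitely supported sequences (filters) $u:\mathbb{Z}^d\to\mathbb{C}^{r\times s}$; $\widehat{u}(\xi)=\sum_{k\in\mathbb{Z}^d}u(k)e^{-ik\cdot\xi}$. The norm on $(l_p(\mathbb{Z}^d))^{r\times s}$ is the sum of the $l_p$ norms of the entries. $I_r$ is the $r\times r$ identity matrix. $\boldsymbol{\delta}(0)=1$ and $\boldsymbol{\delta}(k)=0$ for $k\neq0$ (also used for its restriction to $\mathbb{Z}^d$). Convolution: $[v*w](k)=\sum_{z\in\mathbb{Z}^d}v(z)w(k-z)$. For matrices of smooth functions, $f(\xi)=g(\xi)+O(\|\xi\|^{j})$, $\xi\to0$, means $\partial^\mu f(0)=\partial^\mu g(0)$ for all $\mu\in\mathbb{N}_0^d$ with $|\mu|\le j-1$. $\Omega_{\mathsf{M}I_d}=[\mathsf{M}^{-1}\mathbb{Z}^d]\cap[0,1)^d$. The subdivision operator is $[\mathcal{S}_{a,\mathsf{M}I_d}v](k)=\mathsf{M}^d\sum_{z\in\mathbb{Z}^d}v(z)a(k-\mathsf{M}z)$ for $v\in(l_0(\mathbb{Z}^d))^{s\times r}$. Smoothness exponent. For $y\in(l_0(\mathbb{Z}^d))^{1\times r}$ with $\widehat y(0)\ne0$, let $V_{-1,y}=(l_0(\mathbb{Z}^d))^{r\times1}$ and, for $j\in\mathbb{N}_0$, $V_{j,y}=\{w\in(l_0(\mathbb{Z}^d))^{r\times1}:\widehat y(\xi)\widehat w(\xi)=O(\|\xi\|^{j+1}),\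 \xi\to0\}$. For $j\in\mathbb{N}_0$, $$\rho_j(a,\mathsf{M}I_d,y)_p=\sup\Big\{\limsup_{n\to\infty}\|[\mathcal{S}_{a,\mathsf{M}I_d}^n(\boldsymbol{\delta}I_r)]*w\|_{(l_p(\mathbb{Z}^d))^{r\times1}}^{1/n}:\ w\in V_{j-1,y}\Big\}.$$ $\mathrm{sr}(a,\mathsf{M}I_d)$ is the supremum of all $j\in\mathbb{N}_0$ for which there is $y\in(l_0(\mathbb{Z}^d))^{1\times r}$ with (A) $\widehat y(0)\ne0$ and $\widehat y(\mathsf{M}\xi)\widehat a(\xi+2\pi\omega)=\boldsymbol{\delta}(\omega)\widehat y(\xi)+O(\|\xi\|^j)$, $\xi\to0$, for all $\omega\in\Omega_{\mathsf{M}I_d}$. With $m_a=\mathrm{sr}(a,\mathsf{M}I_d)$, $\rho(a,\mathsf{M}I_d)_p$ is the infimum of $\rho_j(a,\mathsf{M}I_d,y)_p$ over all $j\in\{0,\dots,m_a\}$ and all $y\in(l_0(\mathbb{Z}^d))^{1\times r}$ satisfying (A) with this $j$. Finally $\mathrm{sm}_p(a,\mathsf{M}I_d)=\frac dp-\log_{\mathsf{M}}\rho(a,\mathsf{M}I_d)_p$ (with $d/p=0$ if $p=\infty$). *)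

(* Defs.v *)
From HB Require Import structures.
From mathcomp Require Import all_boot all_order all_algebra.
From mathcomp Require Export complex.
From mathcomp Require Import all_classical all_reals all_analysis.

Set Implicit Arguments.
Unset Strict Implicit.
Unset Printing Implicit Defensive.
Import Order.TTheory GRing.Theory Num.Theory.
Import numFieldNormedType.Exports.
Local Open Scope classical_set_scope.
Local Open Scope ring_scope.

Section Filters.
Variables (R : realType) (d : nat).
Local Notation C := R[i].

Definition fseq (r s : nat) := 'rV[int]_d -> 'M[C]_(r, s).

(* Membership in (l_0(Z^d))^{r x s}. All sums over Z^d below are finitely
   supported sums, well defined as soon as the filters are in l_0. *)
Definition l0 r s (u : fseq r s) : Prop := finite_set [set k | u k != 0].

(* Kronecker delta, used both on Z^d and on Omega. *)
Definition delta (V : zmodType) (x : V) : C := (x == 0)%:R.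

Definition dotZR (k : 'rV[int]_d) (xi : 'rV[R]_d) : R :=
  \sum_(i < d) (k 0 i)%:~R * xi 0 i.

Definition expi (t : R) : C := Complex (cos t) (sin t).

Definition fourier r s (u : fseq r s) (xi : 'rV[R]_d) : 'M[C]_(r, s) :=
  \sum_(k \in [set: 'rV[int]_d]) expi (- dotZR k xi) *: u k.

Definition conv r s t (v : fseq r s) (w : fseq s t) : fseq r t :=
  fun k => \sum_(z \in [set: 'rV[int]_d]) v z *m w (k - z).

(* Partial derivative of a complex-valued function of d real variables: the
   real and imaginary parts are differentiated separately. *)
Definition pderiv (i : 'I_d) (f : 'rV[R]_d -> C) : 'rV[R]_d -> C :=
  fun xi => Complex ('D_(delta_mx 0 i) (fun x => complex.Re (f x)) xi)
                    ('D_(delta_mx 0 i) (fun x => complex.Im (f x)) xi).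

Definition pderivn (mu : 'I_d -> nat) (f : 'rV[R]_d -> C) : 'rV[R]_d -> C :=
  foldr (fun i g => iter (mu i) (pderiv i) g) f (enum 'I_d).

(* f(xi) = g(xi) + O(||xi||^j) as xi -> 0, for smooth f and g. *)
Definition eq_bigO r s (j : nat) (f g : 'rV[R]_d -> 'M[C]_(r, s)) : Prop :=
  forall mu : 'I_d -> nat, (\sum_(i < d) mu i < j)%N ->
  forall (k : 'I_r) (l : 'I_s),
    pderivn mu (fun xi => f xi k l) 0 = pderivn mu (fun xi => g xi k l) 0.

Definition Omega (M : nat) : set 'rV[R]_d :=
  [set w | (exists z : 'rV[int]_d, w = M%:R^-1 *: map_mx intr z) /\
           forall i, 0 <= w 0 i < 1].

Definition subdivision r s (M : nat) (a : fseq r r) (v : fseq s r) :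
    fseq s r :=
  fun k => M%:R ^+ d *:
    \sum_(z \in [set: 'rV[int]_d]) v z *m a (k - M%:Z *: z).

Definition deltaI r : fseq r r := fun k => delta k *: 1%:M.

Definition lp_norm1 (p : \bar R) (u : 'rV[int]_d -> C) : \bar R :=
  match p with
  | q%:E => ((\esum_(k in [set: 'rV[int]_d])
               ((ComplexField.Normc.normc (u k)) `^ q)%:E) `^ q^-1)%E
  | _ => ereal_sup [set (ComplexField.Normc.normc (u k))%:E |
                     k in [set: 'rV[int]_d]]
  end.

Definition lp_norm (p : \bar R) r s (u : fseq r s) : \bar R :=
  (\sum_(i < r) \sum_(j < s) lp_norm1 p (fun k => u k i j))%E.

(* Indices are shifted by one: Vspace j y is V_{j-1,y}, so that
   Vspace 0 y is the whole of (l_0(Z^d))^{r x 1}. *)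
Definition Vspace r (j : nat) (y : fseq 1 r) : set (fseq r 1) :=
  [set w | l0 w /\
     eq_bigO j (fun xi => fourier y xi *m fourier w xi) (fun=> 0)].

Definition rho_j r (M : nat) (p : \bar R) (a : fseq r r) (j : nat)
    (y : fseq 1 r) : \bar R :=
  ereal_sup [set limn_esup (fun n : nat =>
      (lp_norm p (conv (iter n (subdivision M a) (deltaI r)) w)
         `^ n%:R^-1)%E) | w in Vspace j y].

Definition matching_filter r (M : nat) (a : fseq r r) (j : nat)
    (y : fseq 1 r) : Prop :=
  fourier y 0 != 0 /\
  forall w, Omega M w ->
    eq_bigO j
      (fun xi => fourier y (M%:R *: xi) *m fourier a (xi + (2 * pi) *: w))
      (fun xi => delta w *: fourier y xi).

(* The supremum is taken in the extended reals: if it is +oo, then rho below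
   ranges over all j. *)
Definition sr r (M : nat) (a : fseq r r) : \bar R :=
  ereal_sup [set j%:R%:E | j in
    [set j : nat | exists y : fseq 1 r, l0 y /\ matching_filter M a j y]].

Definition rho r (M : nat) (p : \bar R) (a : fseq r r) : \bar R :=
  ereal_inf [set x | exists (j : nat) (y : fseq 1 r),
    [/\ (j%:R%:E <= sr M a)%E, l0 y, matching_filter M a j y &
        x = rho_j M p a j y]].

(* Logarithm to the base M; log_M 0 = -oo. *)
Definition logM (M : nat) (x : \bar R) : \bar R :=
  (lne x * ((ln (M%:R : R))^-1)%:E)%E.

Definition d_over (p : \bar R) : \bar R :=
  match p with q%:E => (d%:R / q)%:E | _ => 0%E end.

Definition sm r (M : nat) (p : \bar R) (a : fseq r r) : \bar R :=
  (d_over p - logM M (rho M p a))%E.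

End Filters.

(* Main.v *)
(* Write A_n = S_a^n(delta I) and, for w in (l_0)^r, let T_g w be the coset sequence
   k |-> M^d (a * w)(M k + g), so that (A_(n+1) * w)(M k + g) = (A_n * T_g w)(k).

   Upper bound. If y is an order j matching filter and w lies in V_(n-1,y) with n < j,
   the sum rules give T_g w - M^-n w in V_(n,y).  Hence the norms x_k of A_k * w satisfy
   x_(k+1) <= M^(d/p - n) x_k + (terms coming from V_(n,y)), and descending induction
   from n = j bounds the growth rate on V_(n-1,y) by max(M^(d/p - n), rho_j(a, y)).

   Lower bound. Suppose the t-jets of two matching filters agree up to a scalar c but no
   choice of c extends the agreement to degree t.  Then some t-th moment U of their
   difference is a left eigenvector of the symbol of a at 0, for the eigenvalue M^-t, and
   is not a multiple of the symbol of y at 0.  A sequence w in V_(j-1,y) not killed by U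
   satisfies |U sum_k (A_n * w)(k)| = const M^((d - t) n), and since A_n * w is supported
   in a box of size O(M^n), rho_j(a, y) >= M^(d/p - t).

   Given (j, y), let t be least with M^(d/p - t) <= rho_j(a, y); the hypothesis on sm
   gives t <= k0.  Below degree n = min(t, j) the jets of v are then proportional to those
   of y, so V_(k0-1,v) is contained in V_(n-1,y), where the growth rate is at most
   rho_j(a, y). *)

Require Import Defs.
From HB Require Import structures.
From mathcomp Require Import all_boot all_order all_algebra.
From mathcomp Require Import all_classical all_reals all_analysis.
From mathcomp Require Import ring lra zify.
Import Order.TTheory GRing.Theory Num.Theory.
Import numFieldNormedType.Exports.
Local Open Scope classical_set_scope.
Local Open Scope ring_scope.

Set Implicit Arguments.
Unset Strict Implicit.
Unset Printing Implicit Defensive.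

Local Notation conv := Defs.conv.
Local Notation normc := ComplexField.Normc.normc.

(** * Finitely supported sums *)

Section FiniteSums.
Variables (T : choiceType) (V : zmodType).
Implicit Types (f g : T -> V).

Definition finsupp f := finite_set [set k | f k != 0].

Lemma finsuppP f :
  finsupp f -> exists X : seq T, uniq X /\ forall k, k \notin X -> f k = 0.
Proof.
move=> /finite_seqP[X fX]; exists (undup X); split=> [|k]; first exact: undup_uniq.
rewrite mem_undup => kX; apply/eqP; apply: contraNT kX => fk.
by have : [set` X] k by rewrite -fX.
Qed.

Lemma seq_finsupp (X : seq T) f : (forall k, k \notin X -> f k = 0) -> finsupp f.
Proof.
move=> fX; apply: (@sub_finite_set _ _ [set` X]); last exact: finite_seq.
by move=> k /=; apply: contraNT => kX; rewrite fX.
Qed.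

Lemma fsumE (X : seq T) f : uniq X -> (forall k, k \notin X -> f k = 0) ->
  \sum_(k \in [set: T]) f k = \sum_(k <- X) f k.
Proof.
move=> uX fX; rewrite (fsbigE X)//; last by move=> i _; exact: fX.
by apply: eq_bigl => i; rewrite in_setT.
Qed.

Arguments fsumE X {f}.

Lemma eq_fsum f g : f =1 g ->
  \sum_(k \in [set: T]) f k = \sum_(k \in [set: T]) g k.
Proof. by move=> fg; apply: eq_fsbigr => k _; exact: fg. Qed.

Lemma fsum0 f : (forall k, f k = 0) -> \sum_(k \in [set: T]) f k = 0.
Proof. by move=> f0; apply: fsbig1 => k _; exact: f0. Qed.

Lemma fsumD f g : finsupp f -> finsupp g ->
  \sum_(k \in [set: T]) (f k + g k) =
  \sum_(k \in [set: T]) f k + \sum_(k \in [set: T]) g k.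
Proof.
move=> /finsuppP[X [uX fX]] /finsuppP[Y [uY gY]].
have H k : k \notin undup (X ++ Y) -> f k = 0 /\ g k = 0.
  by rewrite mem_undup mem_cat negb_or => /andP[/fX-> /gY->].
rewrite !(fsumE (undup (X ++ Y))) ?undup_uniq ?big_split// => k /H[] // -> ->.
by rewrite addr0.
Qed.

End FiniteSums.
Arguments fsumE {T V} X {f}.

(** The hypothesis confines the support of [F] to a finite rectangle, so both iterated sums are
    finite double sums. *)
Lemma exchange_fsum (T T' : choiceType) (V : zmodType) (F : T -> T' -> V) (X : seq T) (Y : seq T') :
  (forall k l, ~~ ((k \in X) && (l \in Y)) -> F k l = 0) ->
  \sum_(k \in [set: T]) \sum_(l \in [set: T']) F k l =
  \sum_(l \in [set: T']) \sum_(k \in [set: T]) F k l.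
Proof.
move=> F0.
have EY k : \sum_(l \in [set: T']) F k l = \sum_(l <- undup Y) F k l.
  rewrite (fsumE (undup Y)) ?undup_uniq// => l; rewrite mem_undup => lY.
  by rewrite F0// (negPf lY) andbF.
have EX l : \sum_(k \in [set: T]) F k l = \sum_(k <- undup X) F k l.
  rewrite (fsumE (undup X)) ?undup_uniq// => k; rewrite mem_undup => kX.
  by rewrite F0// (negPf kX).
rewrite (fsumE (undup X)) ?undup_uniq//; last first.
  by move=> k; rewrite mem_undup => kX; rewrite fsum0// => l; rewrite F0 ?(negPf kX).
rewrite [RHS](fsumE (undup Y)) ?undup_uniq//; last first.
  by move=> l; rewrite mem_undup => lY; rewrite fsum0// => k;
     rewrite F0 ?(negPf lY) ?andbF.
by under eq_bigr do rewrite EY; under [RHS]eq_bigr do rewrite EX; rewrite exchange_big.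
Qed.

Arguments exchange_fsum {T T' V F} X Y.

Lemma raddf_fsum (T : choiceType) (V W : zmodType) (h : {additive V -> W}) (f : T -> V) :
  finsupp f ->
  h (\sum_(k \in [set: T]) f k) = \sum_(k \in [set: T]) h (f k).
Proof.
move=> /finsuppP[X [uX fX]]; rewrite !(fsumE X)// ?raddf_sum// => k /fX->.
by rewrite raddf0.
Qed.

Lemma finsuppD (T : choiceType) (V : zmodType) (f g : T -> V) :
  finsupp f -> finsupp g -> finsupp (fun k => f k + g k).
Proof.
move=> /finsuppP[X [uX fX]] /finsuppP[Y [uY gY]]; apply: (@seq_finsupp _ _ (X ++ Y)).
by move=> k; rewrite mem_cat negb_or => /andP[/fX-> /gY->]; rewrite addr0.
Qed.

Lemma finsupp_can (T T' : choiceType) (V : zmodType) (f : T -> V) (h : T' -> T) h' :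
  cancel h h' -> finsupp f -> finsupp (f \o h).
Proof.
move=> hK /finsuppP[X [uX fX]]; apply: (@seq_finsupp _ _ [seq h' x | x <- X]) => k.
by move=> kX; apply: fX; apply: contra kX => hX; apply/mapP; exists (h k).
Qed.

Lemma fsum_sum (T : choiceType) (V : zmodType) (I : Type) (X : seq I) (F : I -> T -> V) :
  (forall i, finsupp (F i)) ->
  \sum_(k \in [set: T]) \sum_(i <- X) F i k = \sum_(i <- X) \sum_(k \in [set: T]) F i k.
Proof.
move=> finF; suff [] : finsupp (fun k => \sum_(i <- X) F i k) /\
  \sum_(k \in [set: T]) \sum_(i <- X) F i k =
  \sum_(i <- X) \sum_(k \in [set: T]) F i k by [].
elim: X => [|i X [finX IH]].
  split; first by apply: (@seq_finsupp _ _ [::]) => k _; rewrite big_nil.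
  by rewrite big_nil; apply: fsum0 => k; rewrite big_nil.
have E k : \sum_(i0 <- i :: X) F i0 k = F i k + \sum_(i0 <- X) F i0 k.
  by rewrite big_cons.
by split; [rewrite (funext E); exact: finsuppD | rewrite (eq_fsum E) fsumD// IH big_cons].
Qed.

Lemma fsum_shift (U V : zmodType) (f : U -> V) (x : U) :
  \sum_(k \in [set: U]) f k = \sum_(k \in [set: U]) f (k + x).
Proof.
apply: (reindex_fsbigT (fun k => k + x)).
by exists (fun k => k - x) => k; rewrite ?addrK ?subrK.
Qed.

(** * Jets at the origin of exponential sums *)

Section Jets.
Variables (R : realType) (d : nat).
Local Notation C := R[i].
Local Open Scope complex_scope.

(** Reduces a directional derivative to one real variable, where the rules for sine, cosine and
    composition are available. *)
Lemma derive_line (V : normedModType R) (f : V -> R) (x v : V) :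
  'D_v f x = 'D_1 (fun h : R => f (h *: v + x)) 0.
Proof.
rewrite /derive; suff -> : (fun h : R => h^-1 *: ((((fun h : R => f (h *: v + x)) \o
    shift 0) (h *: (1 : R))) - f (0 *: v + x))) =
  (fun h : R => h^-1 *: ((f \o shift x) (h *: v) - f x)) by [].
by apply/funext => h /=; rewrite addr0 scale0r add0r [_ *: 1]mulr1.
Qed.

(** Along a line, the real and the imaginary part of an exponential sum both have this shape, with
    [A + iB] the coefficient for the real part and [-i] times it for the imaginary part. *)
Lemma is_derive_trig_sum (I : Type) (X : seq I) (A B t p : I -> R) :
  is_derive (0 : R) 1
    (fun h => \sum_(i <- X) (A i * cos (h * t i + p i) - B i * sin (h * t i + p i)))
    (\sum_(i <- X) (- (A i * t i * sin (p i)) - B i * t i * cos (p i))).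
Proof.
elim: X => [|i X IH].
  rewrite big_nil.
  under [fun h => _]funext => h do rewrite big_nil.
  exact: is_derive_cst.
rewrite big_cons.
under [fun h => _]funext => h do rewrite big_cons.
have lin : is_derive (0 : R) (1 : R) (fun h : R => h * t i + p i) (t i).
  by apply: is_derive_eq; rewrite ?scaler0 ?addr0 ?add0r [_ *: 1]mulr1.
have hc : is_derive (0 : R) (1 : R) (fun h : R => cos (h * t i + p i)) (- (t i * sin (p i))).
  have H := @is_derive1_comp _ cos (fun h : R => h * t i + p i) 0 _ _ (is_derive_cos _) lin.
  by apply: (is_derive_eq H); rewrite mul0r add0r mulrC mulrN.
have hs : is_derive (0 : R) (1 : R) (fun h : R => sin (h * t i + p i)) (t i * cos (p i)).
  have H := @is_derive1_comp _ sin (fun h : R => h * t i + p i) 0 _ _ (is_derive_sin _) lin.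
  by apply: (is_derive_eq H); rewrite mul0r add0r mulrC.
have H1 := is_deriveZ (A i) hc.
have H2 := is_deriveZ (B i) hs.
have H3 := is_deriveB H1 H2.
apply: (is_derive_eq (is_deriveD H3 IH)).
by rewrite /GRing.scale/= mulrN !mulrA.
Qed.

(** Exponential sums with arbitrary real frequencies contain the symbols, their dilates, shifts and
    products, and are stable under [pderiv]. All derivatives can thus be computed without a product
    rule. *)
Definition exp_sum (I : Type) (X : seq I) (c : I -> C) (th : I -> 'I_d -> R)
    (xi : 'rV[R]_d) : C :=
  \sum_(i <- X) c i * expi (\sum_j th i j * xi 0 j).

Lemma pderiv_exp_sum (I : Type) (X : seq I) c th (j : 'I_d) :
  pderiv j (@exp_sum I X c th) = exp_sum X (fun i => c i * ('i * (th i j)%:C)) th.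
Proof.
apply/funext => xi.
pose p i := \sum_j th i j * xi 0 j.
have ph i h : \sum_k th i k * (h *: delta_mx 0 j + xi) 0 k = h * th i j + p i.
  rewrite /p.
  under eq_bigr do rewrite !mxE eqxx mulrDr.
  rewrite big_split/=; congr (_ + _); rewrite (bigD1 j)//= eqxx mulr1 mulrC.
  by rewrite big1 ?addr0// => k /negPf kj; rewrite kj !mulr0.
have ReE h : complex.Re (exp_sum X c th (h *: delta_mx 0 j + xi)) =
    \sum_(i <- X) (complex.Re (c i) * cos (h * th i j + p i) -
                   complex.Im (c i) * sin (h * th i j + p i)).
  by rewrite /exp_sum raddf_sum; apply: eq_bigr => i _; rewrite ph; case: (c i).
have ImE h : complex.Im (exp_sum X c th (h *: delta_mx 0 j + xi)) =
    \sum_(i <- X) (complex.Im (c i) * cos (h * th i j + p i) -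
                   (- complex.Re (c i)) * sin (h * th i j + p i)).
  rewrite /exp_sum raddf_sum; apply: eq_bigr => i _; rewrite ph; case: (c i) => x y /=.
  by rewrite mulNr opprK addrC.
have -> : pderiv j (exp_sum X c th) xi =
    Complex (\sum_(i <- X) (- (complex.Re (c i) * th i j * sin (p i)) -
                            complex.Im (c i) * th i j * cos (p i)))
            (\sum_(i <- X) (- (complex.Im (c i) * th i j * sin (p i)) -
                            (- complex.Re (c i)) * th i j * cos (p i))).
  rewrite /pderiv; congr Complex; rewrite derive_line.
    rewrite (funext ReE).
    exact: (@derive_val _ _ _ _ _ _ _ (is_derive_trig_sum X _ _ _ _)).
  rewrite (funext ImE).
  exact: (@derive_val _ _ _ _ _ _ _ (is_derive_trig_sum X _ _ _ _)).
rewrite /exp_sum; apply/eqP; rewrite eq_complex; apply/andP; split; apply/eqP.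
  rewrite [RHS]raddf_sum/=; apply: eq_bigr => i _; rewrite -/(p i); case: (c i) => x y /=.
  ring.
rewrite [RHS]raddf_sum/=; apply: eq_bigr => i _; rewrite -/(p i); case: (c i) => x y /=.
ring.
Qed.

Lemma pderivn_exp_sum (I : Type) (X : seq I) c th (mu : 'I_d -> nat) :
  pderivn mu (@exp_sum I X c th) =
  exp_sum X (fun i => c i * \prod_j ('i * (th i j)%:C) ^+ mu j) th.
Proof.
rewrite /pderivn.
have it j n c' : iter n (pderiv j) (exp_sum X c' th) =
    exp_sum X (fun i => c' i * ('i * (th i j)%:C) ^+ n) th.
  elim: n => [|n IH] /=; first by congr exp_sum; apply/funext => i; rewrite expr0 mulr1.
  rewrite IH pderiv_exp_sum; congr exp_sum; apply/funext => i.
  by rewrite exprSr -!mulrA.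
have -> : (fun i => c i * \prod_j ('i * (th i j)%:C) ^+ mu j) =
          (fun i => c i * \prod_(j <- enum 'I_d) ('i * (th i j)%:C) ^+ mu j).
  by apply/funext => i; rewrite big_enum.
elim: (enum _) => [|j s IH] /=.
  by congr exp_sum; apply/funext => i; rewrite big_nil mulr1.
rewrite IH it; congr exp_sum; apply/funext => i.
by rewrite big_cons -mulrA; congr (_ * _); rewrite mulrC.
Qed.

Lemma exp_sum0 (I : Type) (X : seq I) c (th : I -> 'I_d -> R) :
  exp_sum X c th 0 = \sum_(i <- X) c i.
Proof.
apply: eq_bigr => i _; rewrite big1 => [|j _]; last by rewrite mxE mulr0.
by rewrite /expi cos0 sin0 mulr1.
Qed.

Lemma prod_count (T : finType) (s : seq T) (f : T -> C) :
  \prod_(j <- s) f j = \prod_j f j ^+ count_mem j s.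
Proof.
elim: s => [|x s IH]; first by rewrite big_nil big1.
rewrite big_cons IH; under [RHS]eq_bigr do rewrite /= exprD.
rewrite [RHS]big_split/=; congr (_ * _); rewrite (bigD1 x)//= eqxx expr1.
by rewrite big1 ?mulr1// => j /negPf jx; rewrite eq_sym jx.
Qed.

Lemma sum_count_mem (T : finType) (s : seq T) : (\sum_i count_mem i s = size s)%N.
Proof.
elim: s => [|x s IH]; first by rewrite big1.
rewrite /= big_split/= IH (bigD1 x)//= eqxx big1 ?addn0// => j /negPf jx.
by rewrite eq_sym jx.
Qed.

Lemma seq_of_count (mu : 'I_d -> nat) :
  exists s : seq 'I_d, forall i, mu i = count_mem i s.
Proof.
exists (flatten [seq nseq (mu i) i | i <- enum 'I_d]) => i.
rewrite count_flatten -map_comp sumnE big_map big_enum/= (bigD1 i)//=.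
rewrite count_nseq/= eqxx mul1n big1 ?addn0// => j /negPf ji.
by rewrite count_nseq/= ji.
Qed.

(** Every derivative brings down ['i] times a frequency, so a derivative at 0 is a power of ['i]
    times a moment of the frequencies. Both sides carry the same power, which is cancelled. The
    index types differ because a product of two symbols is compared with a single one. *)
Lemma exp_sum_jets (I I' : Type) (X : seq I) (X' : seq I') c c'
    (th : I -> 'I_d -> R) (th' : I' -> 'I_d -> R) (j : nat) :
  (forall mu : 'I_d -> nat, (\sum_(i < d) mu i < j)%N ->
    pderivn mu (exp_sum X c th) 0 = pderivn mu (exp_sum X' c' th') 0) <->
  (forall s : seq 'I_d, (size s < j)%N ->
    \sum_(i <- X) (\prod_(k <- s) (th i k)%:C) * c i =
    \sum_(i <- X') (\prod_(k <- s) (th' i k)%:C) * c' i).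
Proof.
have I0 n : ('i : C) ^+ n != 0 by rewrite expf_neq0// eq_complex /= eqxx oner_eq0.
have aux (J : Type) (Y : seq J) e (ph : J -> 'I_d -> R) mu s :
    (forall i, mu i = count_mem i s) ->
    pderivn mu (exp_sum Y e ph) 0 =
    'i ^+ size s * \sum_(i <- Y) (\prod_(k <- s) (ph i k)%:C) * e i.
  move=> mus; rewrite pderivn_exp_sum exp_sum0 mulr_sumr; apply: eq_bigr => i _.
  under eq_bigr do rewrite mus.
  rewrite -prod_count big_split/= big_const_seq count_predT iter_mulr_1 mulrCA.
  by rewrite [e i * _]mulrC.
split=> H.
  move=> s sj; apply: (mulfI (I0 (size s))).
  rewrite -!(aux _ _ _ _ (fun i => count_mem i s))//.
  apply: H; apply: leq_ltn_trans sj.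
  by rewrite sum_count_mem.
move=> mu; have [s mus] := seq_of_count mu.
under eq_bigr do rewrite mus.
rewrite sum_count_mem => sj; rewrite !(aux _ _ _ _ mu s)//.
by congr (_ * _); exact: H.
Qed.
End Jets.

(** * Characters and roots of unity *)

Section Expi.
Variable R : realType.
Local Notation C := R[i].

Lemma expi0 : expi (0 : R) = 1.
Proof. by rewrite /expi cos0 sin0. Qed.

Lemma expiD (x y : R) : expi (x + y) = expi x * expi y :> C.
Proof. by rewrite /expi cosD sinD; apply/eqP; rewrite eq_complex /= eqxx addrC eqxx. Qed.

Lemma expi_sum (I : Type) (s : seq I) (f : I -> R) :
  expi (\sum_(i <- s) f i) = \prod_(i <- s) expi (f i) :> C.
Proof. by elim: s => [|i s IH]; rewrite ?big_nil ?expi0// !big_cons expiD IH. Qed.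

Lemma expiMn (x : R) (n : nat) : expi (n%:R * x) = expi x ^+ n :> C.
Proof.
elim: n => [|n IH]; first by rewrite mul0r expi0.
by rewrite -natr1 mulrDl mul1r expiD IH exprSr.
Qed.

Lemma expi_2pi_int (n : int) : expi (2 * pi * n%:~R : R) = 1.
Proof.
have H m : expi (2 * pi * m%:R : R) = 1.
  by rewrite mulrC expiMn /expi mulr_natl cos2pi sin2pi expr1n.
case: n => n; first exact: H.
have := expiD (2 * pi * (n.+1)%:R) (- (2 * pi * (n.+1)%:R)).
by rewrite subrr expi0 H mul1r NegzE mulrNz mulrN => ->.
Qed.

(** Modulo [M] the numerator becomes some [t < M]. For [t > 0], the double-angle formula turns
    [cos (2 pi t / M) = 1] into [sin (pi t / M) = 0], impossible strictly between 0 and [pi]. *)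
Lemma expi_root_eq1 (M : nat) (n : int) : (0 < M)%N ->
  (expi (2 * pi * (n%:~R / M%:R) : R) == 1) = (M%:Z %| n)%Z.
Proof.
move=> M0; have MR : (M%:R : R) != 0 by rewrite pnatr_eq0 -lt0n.
have -> : n%:~R / M%:R = (n %/ M%:Z)%Z%:~R + (n %% M%:Z)%Z%:~R / M%:R :> R.
  rewrite {1}(divz_eq n M%:Z) intrD intrM -[M%:Z%:~R]pmulrn [LHS]mulrDl.
  by rewrite mulfK.
rewrite mulrDr expiD expi_2pi_int mul1r (sameP dvdz_mod0P eqP).
have Mz : (M%:Z != 0) by rewrite eqz_nat -lt0n.
have := modz_ge0 n Mz; have : (n %% M%:Z)%Z < M%:Z by rewrite ltz_pmod.
case: (n %% M%:Z)%Z => // t; rewrite ltz_nat => tM _.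
have [->|t0] := eqVneq t 0%N; first by rewrite mul0r mulr0 expi0 !eqxx.
have -> : (Posz t == 0) = false by apply/eqP => -[/eqP]; rewrite (negPf t0).
apply/eqP => -[+ _].
set x : R := t%:~R / M%:R.
have -> : 2 * pi * x = (pi * x) *+ 2 by rewrite mulr2n; ring.
rewrite cos_mulr2n cos2sin2 => H.
have : 0 < sin (pi * x).
  apply: sin_gt0_pi; rewrite mulr_gt0 ?pi_gt0 ?divr_gt0 ?ltr0n ?lt0n//=.
  by rewrite gtr_pMr ?pi_gt0// ltr_pdivrMr ?ltr0n// mul1r ltr_nat.
move=> s0; have : sin (pi * x) ^+ 2 = 0 by lra.
by move/eqP; rewrite expf_eq0/= gt_eqF.
Qed.
End Expi.

(** * Jets and moments *)

Section Moments.
Variables (R : realType) (d : nat).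
Local Notation C := R[i].
Local Notation T := 'rV[int]_d.
Local Notation fseq := (fseq R d).

(* A multi-index [mu] is encoded by a list of coordinates in which each [i] occurs
   [mu i] times, so [size s] is its degree. *)
Definition mon (s : seq 'I_d) (x : 'I_d -> C) : C := \prod_(i <- s) x i.
Definition zc (k : T) : 'I_d -> C := fun i => (k 0 i)%:~R.
Definition mom (r t : nat) (s : seq 'I_d) (u : fseq r t) : 'M[C]_(r, t) :=
  \sum_(k \in [set: T]) mon s (zc k) *: u k.

Lemma fourierE r t (u : fseq r t) (X : seq T) xi : uniq X ->
  (forall k, k \notin X -> u k = 0) ->
  fourier u xi = \sum_(k <- X) expi (- dotZR k xi) *: u k.
Proof. by move=> uX u0; apply: fsumE => // k /u0 ->; rewrite scaler0. Qed.

Lemma fourier0 r t (u : fseq r t) : fourier u 0 = mom [::] u.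
Proof.
apply: eq_fsum => k; rewrite /mon big_nil /dotZR big1 ?oppr0 ?expi0// => i _.
by rewrite mxE mulr0.
Qed.

Lemma momE r t s (u : fseq r t) (X : seq T) : uniq X ->
  (forall k, k \notin X -> u k = 0) ->
  mom s u = \sum_(k <- X) mon s (zc k) *: u k.
Proof. by move=> uX u0; apply: fsumE => // k /u0 ->; rewrite scaler0. Qed.

(* Both the matching conditions and the spaces V are conditions on the jets at 0
   of functions of this form. *)
Lemma fourier_mul_exp_sum r t q (m : nat) (y : fseq r t) (u : fseq t q)
    (X Y : seq T) (om : 'rV[R]_d) i j : uniq X -> uniq Y ->
  (forall k, k \notin X -> y k = 0) -> (forall k, k \notin Y -> u k = 0) ->
  (fun xi => (fourier y (m%:R *: xi) *m fourier u (xi + (2 * pi) *: om)) i j) =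
  exp_sum [seq (k, l) | k <- X, l <- Y]
    (fun p => expi (- (2 * pi * dotZR p.2 om)) * (y p.1 *m u p.2) i j)
    (fun p c => - (m%:R * (p.1 0 c)%:~R + (p.2 0 c)%:~R)).
Proof.
move=> uX uY y0 u0; apply/funext => xi.
rewrite (fourierE _ uX y0) (fourierE _ uY u0) mulmx_suml summxE /exp_sum big_allpairs.
apply: eq_bigr => k _; rewrite mulmx_sumr summxE; apply: eq_bigr => l _ /=.
rewrite -scalemxAl -scalemxAr scalerA mxE -expiD mulrAC -expiD; congr (expi _ * _).
have -> : \sum_c - (m%:R * (k 0 c)%:~R + (l 0 c)%:~R) * xi 0 c =
          - (m%:R * dotZR k xi) - dotZR l xi.
  rewrite -opprD /dotZR mulr_sumr -big_split -sumrN; apply: eq_bigr => c _ /=.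
  by rewrite mulNr mulrDl mulrA.
have -> : dotZR k (m%:R *: xi) = m%:R * dotZR k xi.
  by rewrite /dotZR mulr_sumr; apply: eq_bigr => c _; rewrite mxE mulrCA.
have -> : dotZR l (xi + (2 * pi) *: om) = dotZR l xi + 2 * pi * dotZR l om.
  rewrite /dotZR mulr_sumr -big_split; apply: eq_bigr => c _ /=.
  by rewrite !mxE mulrDr; congr (_ + _); rewrite mulrCA.
ring.
Qed.

Lemma fourier_exp_sum r t (e : C) (y : fseq r t) (X : seq T) i j : uniq X ->
  (forall k, k \notin X -> y k = 0) ->
  (fun xi => (e *: fourier y xi) i j) =
  exp_sum X (fun k => e * y k i j) (fun k c => - (k 0 c)%:~R).
Proof.
move=> uX y0; apply/funext => xi.
rewrite (fourierE _ uX y0) mxE summxE mulr_sumr; apply: eq_bigr => k _ /=.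
rewrite mxE mulrCA [LHS]mulrC; congr (_ * expi _).
by rewrite /dotZR -sumrN; apply: eq_bigr => c _; rewrite mulNr.
Qed.

Lemma monN s (x : 'I_d -> C) : mon s (fun i => - x i) = (-1) ^+ size s * mon s x.
Proof.
rewrite /mon; elim: s => [|c s IH]; first by rewrite !big_nil mul1r.
by rewrite !big_cons IH exprS; ring.
Qed.

Lemma prod_realC s (f : 'I_d -> R) :
  \prod_(c <- s) (- f c)%:C%C = (-1) ^+ size s * mon s (fun c => (f c)%:C%C) :> C.
Proof. by rewrite -monN; apply: eq_bigr => c _; rewrite rmorphN. Qed.

(** The product has frequencies [-(m k + l)] and the shift by [om] contributes the phase. The sign
    [(-1) ^+ size s] coming from the minus in the Fourier transform appears on both sides and
    cancels. Taking [m = M] gives the matching conditions, [m = 1] and [e = 0] the spaces V. *)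
Lemma eq_bigO_fourier_mul r t q (m j : nat) (y : fseq r t) (u : fseq t q)
    (e : C) (v : fseq r q) (X Y Z : seq T) (om : 'rV[R]_d) :
  uniq X -> uniq Y -> uniq Z -> (forall k, k \notin X -> y k = 0) ->
  (forall k, k \notin Y -> u k = 0) -> (forall k, k \notin Z -> v k = 0) ->
  eq_bigO j (fun xi => fourier y (m%:R *: xi) *m fourier u (xi + (2 * pi) *: om))
    (fun xi => e *: fourier v xi) <->
  (forall s, (size s < j)%N ->
    \sum_(k <- X) \sum_(l <- Y) (mon s (zc (m%:Z *: k + l)) *
      expi (- (2 * pi * dotZR l om))) *: (y k *m u l) = e *: mom s v).
Proof.
move=> uX uY uZ y0 u0 v0.
have ij a b : (forall mu : 'I_d -> nat, (\sum_(i < d) mu i < j)%N ->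
    pderivn mu (fun xi => (fourier y (m%:R *: xi) *m
      fourier u (xi + (2 * pi) *: om)) a b) 0 =
    pderivn mu (fun xi => (e *: fourier v xi) a b) 0) <->
  (forall s, (size s < j)%N ->
    (\sum_(k <- X) \sum_(l <- Y) (mon s (zc (m%:Z *: k + l)) *
      expi (- (2 * pi * dotZR l om))) *: (y k *m u l)) a b = (e *: mom s v) a b).
  rewrite (fourier_mul_exp_sum _ _ _ _ uX uY y0 u0) (fourier_exp_sum _ _ _ uZ v0).
  rewrite exp_sum_jets.
  suff H s : (\sum_(i <- [seq (k, l) | k <- X, l <- Y])
     (\prod_(k <- s) (- (m%:R * (i.1 0 k)%:~R + (i.2 0 k)%:~R))%:C%C) *
     (expi (- (2 * pi * dotZR i.2 om)) * (y i.1 *m u i.2) a b) = 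
     (-1) ^+ size s * (\sum_(k <- X) \sum_(l <- Y) (mon s (zc (m%:Z *: k + l)) *
      expi (- (2 * pi * dotZR l om))) *: (y k *m u l)) a b) /\
    (\sum_(i <- Z) (\prod_(k <- s) (- (i 0 k)%:~R)%:C%C) * (e * v i a b) =
     (-1) ^+ size s * (e *: mom s v) a b).
    have S n : injective ( *%R ((-1) ^+ n : C)) by apply: mulfI; rewrite signr_eq0.
    split=> K s sj; have [E1 E2] := H s; have := K s sj.
      by rewrite E1 E2 => /S.
    by rewrite E1 E2 => ->.
  rewrite big_allpairs summxE mulr_sumr; split.
    apply: eq_bigr => k _; rewrite summxE mulr_sumr; apply: eq_bigr => l _ /=.
    rewrite [in RHS]mxE prod_realC !mulrA; congr (_ * _ * _ * _).
    by apply: eq_bigr => c _; rewrite /zc !mxE rmorphD rmorphM/= intrD intrM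
      !rmorph_int rmorph_nat.
  rewrite (momE _ uZ v0) mxE summxE !mulr_sumr; apply: eq_bigr => k _.
  rewrite prod_realC mxE mulrCA !mulrA [e * _]mulrC; congr (_ * _).
  rewrite [_ * e]mulrC; congr (_ * _ * _).
  by apply: eq_bigr => c _; rewrite rmorph_int.
split=> H.
  by move=> s sj; apply/matrixP => a b; apply/(ij a b).1 => // mu muj; exact: H.
by move=> mu muj a b; apply: (ij a b).2 => // s sj; rewrite H.
Qed.

End Moments.
Arguments zc {R d} k.

(** * Moments of convolutions, matching conditions and sum rules *)

Section SumRules.
Variables (R : realType) (d : nat).
Local Notation C := R[i].
Local Notation T := 'rV[int]_d.
Local Notation fseq := (fseq R d).

Lemma conv_notin r t q (y : fseq r t) (u : fseq t q) (X Y : seq T) k :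
  (forall k, k \notin X -> y k = 0) -> (forall k, k \notin Y -> u k = 0) ->
  k \notin [seq x + z | x <- X, z <- Y] -> conv y u k = 0.
Proof.
move=> y0 u0 kXY; apply: fsum0 => z; have [zX|/y0->] := boolP (z \in X).
  rewrite u0 ?mulmx0//; apply: contra kXY => kz.
  by apply/allpairsP; exists (z, k - z); rewrite zX kz/= addrC subrK.
by rewrite mul0mx.
Qed.

Lemma l0_conv r t q (y : fseq r t) (u : fseq t q) : l0 y -> l0 u -> l0 (conv y u).
Proof.
move=> /finsuppP[X [_ y0]] /finsuppP[Y [_ u0]]; apply: seq_finsupp => k.
exact: conv_notin y0 u0.
Qed.

Lemma fsum_conv r t q (g : T -> C) (y : fseq r t) (u : fseq t q) : l0 y -> l0 u ->
  \sum_(k \in [set: T]) g k *: conv y u k =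
  \sum_(k \in [set: T]) \sum_(l \in [set: T]) g (k + l) *: (y k *m u l).
Proof.
move=> /finsuppP[X [_ y0]] /finsuppP[Y [_ u0]].
have E k : g k *: conv y u k = \sum_(z \in [set: T]) g k *: (y z *m u (k - z)).
  apply: (raddf_fsum (GRing.scale (g k))).
  by apply: (@seq_finsupp _ _ X) => z /y0 ->; rewrite mul0mx.
rewrite (eq_fsum E).
pose XY : seq T := [seq x + z | x <- X, z <- Y].
have F0 k z : ~~ ((k \in XY) && (z \in X)) -> g k *: (y z *m u (k - z)) = 0.
  rewrite negb_and => H; have [zX|/y0->] := boolP (z \in X); last by rewrite mul0mx scaler0.
  rewrite u0 ?mulmx0 ?scaler0//; move: H; rewrite zX orbF; apply: contra => kz.
  by apply/allpairsP; exists (z, k - z); rewrite zX kz/= addrC subrK.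
apply: (etrans (exchange_fsum XY X F0)).
apply: eq_fsum => k; apply: (etrans (fsum_shift _ k)); apply: eq_fsum => l.
by rewrite addrK addrC.
Qed.

Lemma fsum2E r t q (G : T -> T -> C) (y : fseq r t) (u : fseq t q) (X Y : seq T) :
  uniq X -> uniq Y -> (forall k, k \notin X -> y k = 0) ->
  (forall k, k \notin Y -> u k = 0) ->
  \sum_(k \in [set: T]) \sum_(l \in [set: T]) G k l *: (y k *m u l) =
  \sum_(k <- X) \sum_(l <- Y) G k l *: (y k *m u l).
Proof.
move=> uX uY y0 u0; rewrite (fsumE X)//; last first.
  by move=> k /y0 yk; apply: fsum0 => l; rewrite yk mul0mx scaler0.
apply: eq_bigr => k _; rewrite (fsumE Y)// => l /u0 ->.
by rewrite mulmx0 scaler0.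
Qed.

Lemma dotZR0 (k : T) : dotZR k (0 : 'rV[R]_d) = 0.
Proof. by rewrite /dotZR big1// => i _; rewrite mxE mulr0. Qed.

Lemma VspaceP r j (y : fseq 1 r) (w : fseq r 1) : l0 y ->
  Vspace j y w <->
  l0 w /\ forall s, (size s < j)%N -> mom s (conv y w) = 0.
Proof.
move=> hy; split=> -[hw H]; split=> //;
  have /finsuppP[X [uX y0]] := hy; have /finsuppP[Y [uY u0]] := hw;
  (* No dilation, no shift, and the zero filter with empty support on the right. *)
  have := @eq_bigO_fourier_mul R d _ _ _ 1 j y w 0 (fun=> 0) X Y [::] 0 uX uY isT y0 u0
    (fun _ _ => erefl);
  under [fun xi => fourier y (_ *: _) *m _]eq_fun do rewrite scale1r scaler0 addr0;
  under [fun xi => 0 *: _]eq_fun do rewrite scale0r.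
  move=> [/(_ H) K _] s sj; rewrite /mom fsum_conv// (fsum2E _ uX uY y0 u0).
  have := K s sj; rewrite scale0r => E; apply: etrans E; apply: eq_bigr => k _.
  by apply: eq_bigr => l _; rewrite dotZR0 mulr0 oppr0 expi0 mulr1 scale1r.
move=> [_]; apply => s sj; rewrite scale0r.
rewrite -[RHS](H s sj) /mom fsum_conv// (fsum2E _ uX uY y0 u0); apply: eq_bigr => k _.
by apply: eq_bigr => l _; rewrite dotZR0 mulr0 oppr0 expi0 mulr1 scale1r.
Qed.

Section Matching.
Variables (r M j : nat) (a : fseq r r) (y : fseq 1 r).
Hypotheses (M_gt0 : (0 < M)%N) (ha : l0 a) (hy : l0 y).
Hypothesis (match_y : matching_filter M a j y).

Lemma mom_nil_neq0 : mom [::] y != 0.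
Proof. by rewrite -fourier0; exact: match_y.1. Qed.

Lemma matching_mom (om : 'rV[R]_d) s : Omega M om -> (size s < j)%N ->
  \sum_(k \in [set: T]) \sum_(l \in [set: T])
    (mon s (zc (M%:Z *: k + l)) * expi (- (2 * pi * dotZR l om))) *: (y k *m a l)
  = delta R om *: mom s y.
Proof.
move=> Mom sj; have /finsuppP[X [uX y0]] := hy; have /finsuppP[Y [uY a0]] := ha.
rewrite (fsum2E _ uX uY y0 a0).
have := @eq_bigO_fourier_mul R d _ _ _ M j y a (delta R om) y X Y X om uX uY uX y0 a0 y0.
by move=> [/(_ (match_y.2 om Mom)) + _]; apply.
Qed.

Lemma Omega0 : Omega M (0 : 'rV[R]_d).
Proof.
split=> [|i]; last by rewrite mxE lexx ltr01.
by exists 0; rewrite map_mx0 scaler0.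
Qed.

Lemma matching_mom0 s : (size s < j)%N ->
  \sum_(k \in [set: T]) \sum_(l \in [set: T])
    mon s (zc (M%:Z *: k + l)) *: (y k *m a l) = mom s y.
Proof.
move=> sj; rewrite -[RHS]scale1r; have := matching_mom Omega0 sj.
rewrite /delta eqxx => <-; apply: eq_fsum => k; apply: eq_fsum => l.
by rewrite dotZR0 mulr0 oppr0 expi0 mulr1.
Qed.

(** The points of [Omega M], indexed by their digits. *)
Let om (z : {ffun 'I_d -> 'I_M}) : 'rV[R]_d := \row_i ((z i)%:R / M%:R).

Let Omega_om z : Omega M (om z).
Proof.
split=> [|i]; first by exists (\row_i (z i : int)); apply/rowP => i; rewrite !mxE mulrC.
rewrite mxE divr_ge0//= ltr_pdivrMr ?ltr0n// mul1r ltr_nat.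
exact: ltn_ord.
Qed.

Let delta_om (z0 : 'I_M) z : z0 = 0%N :> nat -> delta R (om z) = (z == [ffun=> z0])%:R :> C.
Proof.
move=> z00; rewrite /delta; congr (_%:R); congr nat_of_bool; apply/eqP/eqP => [/rowP H|->].
  apply/ffunP => i; have /eqP := H i; rewrite !mxE ffunE mulf_eq0 invr_eq0 !pnatr_eq0.
  by rewrite (gtn_eqF M_gt0) orbF => /eqP zi; apply/val_inj; rewrite /= zi.
by apply/rowP => i; rewrite !mxE ffunE z00 mul0r.
Qed.

(** Orthogonality of the characters of [(Z/M)^d]: the sum factors into one geometric sum per
    coordinate, over an [M]-th root of unity. Each equals [M] if the root is 1, and 0 otherwise. *)
Lemma char_orthogonality (n : T) :
  \sum_z expi (2 * pi * dotZR n (om z)) =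
  if [forall i, (M%:Z %| n 0%R i)%Z] then (M ^ d)%:R else 0 :> C.
Proof.
pose e (i : 'I_d) : C := expi (2 * pi * ((n 0 i)%:~R / M%:R)).
have eM i : e i ^+ M = 1.
  have MR : (M%:R : R) != 0 by rewrite pnatr_eq0 -lt0n.
  rewrite /e -expiMn -(expi_2pi_int R (n 0 i)); congr expi.
  by rewrite mulrCA [M%:R * _]mulrC divfK.
have -> : \sum_z expi (2 * pi * dotZR n (om z)) =
          \sum_(z : {ffun 'I_d -> 'I_M}) \prod_i e i ^+ z i.
  apply: eq_bigr => z _; rewrite /dotZR mulr_sumr expi_sum; apply: eq_bigr => i _.
  by rewrite -expiMn mxE; congr expi; ring.
rewrite -(bigA_distr_bigA (fun i (t : 'I_M) => e i ^+ t)).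
case: forallP => [nM|].
  rewrite natrX -[X in _ ^+ X]card_ord -prodr_const; apply: eq_bigr => i _.
  rewrite (eq_bigr (fun=> 1)) ?sumr_const ?card_ord// => t _.
  move: (nM i); rewrite -(expi_root_eq1 R _ M_gt0) => /eqP.
  by rewrite -/(e i) => ->; rewrite expr1n.
move=> /existsNP[i /negP nMi]; rewrite (bigD1 i)//=.
suff -> : \sum_(t < M) e i ^+ t = 0 by rewrite mul0r.
have e1 : e i - 1 != 0 by rewrite subr_eq0 expi_root_eq1.
by apply: (mulfI e1); rewrite -subrX1 eM subrr mulr0.
Qed.

(** Fourier inversion on [(Z/M)^d]: weighting the matching condition at [om] by the character at [g]
    and summing over [om] isolates the coset of [g] on the left, while only [om = 0] survives on the
    right. Every coset thus carries the same share of the moment. *)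
Lemma sum_rules (g : T) s : (size s < j)%N ->
  \sum_(k \in [set: T]) \sum_(x \in [set: T])
    mon s (zc (M%:Z *: k + (M%:Z *: x + g))) *: (y k *m a (M%:Z *: x + g))
  = (M%:R ^+ d)^-1 *: mom s y.
Proof.
move=> sj; have /finsuppP[X [uX y0]] := hy; have /finsuppP[Y [uY a0]] := ha.
pose z0 := Ordinal M_gt0.
have : \sum_z expi (2 * pi * dotZR g (om z)) *: (delta R (om z) *: mom s y) = mom s y.
  rewrite (bigD1 [ffun=> z0])//= (delta_om (z0 := z0))// eqxx scale1r.
  rewrite big1 => [|z /negPf zz0]; last first.
    by rewrite (delta_om (z0 := z0))// zz0 scale0r scaler0.
  have -> : om [ffun=> z0] = 0 by apply/rowP => i; rewrite !mxE ffunE mul0r.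
  by rewrite dotZR0 mulr0 expi0 scale1r addr0.
under eq_bigr => z _.
  rewrite -(matching_mom (Omega_om z) sj) (fsum2E _ uX uY y0 a0).
  rewrite scaler_sumr; under eq_bigr do rewrite scaler_sumr.
  over.
rewrite exchange_big; under eq_bigr do rewrite exchange_big.
move=> <-.
rewrite scaler_sumr (fsumE X)//; last first.
  by move=> k /y0 yk; apply: fsum0 => l; rewrite yk mul0mx scaler0.
apply: eq_bigr => k _.
(* What orthogonality leaves of the inner sum: the indices congruent to [g] modulo [M]. *)
pose F l := if [forall i, (M%:Z %| (g - l)%R 0%R i)%Z] then
  mon s (zc (M%:Z *: k + l)) *: (y k *m a l) else 0.
have MC : (M%:R : C) != 0 by rewrite pnatr_eq0 -lt0n.
have FE l : (M%:R ^+ d)^-1 *: \sum_z expi (2 * pi * dotZR g (om z)) *: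
    ((mon s (zc (M%:Z *: k + l)) * expi (- (2 * pi * dotZR l (om z)))) *: (y k *m a l))
    = F l.
  under eq_bigr => z _.
    rewrite scalerA mulrCA -expiD mulrC -scalerA.
    have -> : 2 * pi * dotZR g (om z) - 2 * pi * dotZR l (om z) =
              2 * pi * dotZR (g - l) (om z).
      rewrite -mulrBr; congr (_ * _); rewrite /dotZR -sumrB; apply: eq_bigr => i _.
      by rewrite !mxE intrB mulrBl.
    over.
  rewrite -scaler_suml char_orthogonality /F; case: ifP => _; last by rewrite scale0r scaler0.
  by rewrite natrX; apply: scalerK; rewrite expf_neq0.
rewrite scaler_sumr; under [RHS]eq_bigr do rewrite FE.
rewrite -(fsumE Y (f := F)) => //; last by move=> l /a0 al; rewrite /F al mulmx0 scaler0 if_same.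
(* The surviving indices are reparametrised as [M x + g]. *)
rewrite -(fsbig_widen [set M%:Z *: x + g | x in [set: T]] [set: T] F)//; last first.
  move=> l [_ /= nl]; rewrite /F; case: ifP => // /forallP dv.
  exfalso; apply: nl; exists (\row_i ((l - g)%R 0%R i %/ M%:Z)%Z) => //.
  apply/rowP => i; rewrite !mxE mulrC divzK ?subrK//.
  by move: (dv i); rewrite !mxE -opprB rpredN.
rewrite fsbig_image; last first.
  move=> x x' _ _ /addIr/rowP E; apply/rowP => i; have := E i.
  by rewrite !mxE => /mulfI; apply; rewrite eqz_nat -lt0n.
apply: eq_fsum => x; rewrite /F; case: ifPn => // /negP[]; apply/forallP => i.
by rewrite !mxE opprD addrCA subrr addr0 rpredN dvdz_mulr.
Qed.

End Matching.
End SumRules.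

(** * Affine changes of variables and the transition operators *)

Section AffineMoments.
Variables (R : realType) (d : nat) (V : lmodType R[i]).
Local Notation C := R[i].
Implicit Types (L : (('I_d -> C) -> C) -> V).

(** Functionals act on arbitrary functions, not on polynomials, so that multiplication by a
    coordinate and affine substitution are plain compositions. *)
Definition linf L := forall (e : C) f g,
  L (fun x => e * f x + g x) = e *: L f + L g.

Lemma linf0 L : linf L -> L (fun=> 0) = 0.
Proof.
move=> lL; have := lL 1 (fun=> 0) (fun=> 0).
have -> : (fun _ : 'I_d -> C => 1 * 0 + 0 : C) = (fun=> 0).
  by apply/funext => x; rewrite mul1r addr0.
by rewrite scale1r => /eqP; rewrite -subr_eq subrr eq_sym => /eqP.
Qed.

Lemma linfB L L' : linf L -> linf L' -> linf (fun f => L f - L' f).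
Proof.
move=> lL lL' e f g; rewrite lL lL' scalerBr opprD !addrA; congr (_ + _).
by rewrite addrAC.
Qed.

Lemma linfZ L c : linf L -> linf (fun f => c *: L f).
Proof. by move=> lL e f g; rewrite lL scalerDr !scalerA mulrC. Qed.

Lemma linf_eval (x : 'I_d -> C) v : linf (fun f => f x *: v).
Proof. by move=> e f g; rewrite scalerDl scalerA. Qed.

Lemma linf_fsum (T : choiceType) (X : seq T) (L : T -> (('I_d -> C) -> C) -> V) :
  (forall k, linf (L k)) -> (forall k f, k \notin X -> L k f = 0) ->
  linf (fun f => \sum_(k \in [set: T]) L k f).
Proof.
move=> lL L0 e f g.
have fin f' : finsupp (L^~ f') by apply: (@seq_finsupp _ _ X) => k kX; exact: L0.
rewrite (eq_fsum (fun k => lL k e f g)) fsumD//; last first.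
  by apply: (@seq_finsupp _ _ X) => k kX; rewrite L0// scaler0.
by congr (_ + _); apply/esym; apply: (raddf_fsum (GRing.scale e)).
Qed.

Lemma mon_cons c (s : seq 'I_d) (x : 'I_d -> C) : mon (c :: s) x = x c * mon s x.
Proof. by rewrite /mon big_cons. Qed.

(** Expanding the product, the top-degree term is [al ^+ size s] times the monomial, and all other
    terms have lower degree, hence are killed by [L]. *)
Lemma affine_mom (al : C) (be : 'I_d -> C) s L : linf L ->
  (forall s', (size s' < size s)%N -> L (mon s') = 0) ->
  L (fun x => mon s (fun i => al * x i + be i)) = al ^+ size s *: L (mon s).
Proof.
elim: s L => [|c s IH] L lL L0 /=.
  rewrite expr0 scale1r; congr L; apply/funext => x.
  by rewrite /mon !big_nil.
have -> : (fun x : 'I_d -> C => mon (c :: s) (fun i => al * x i + be i)) =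
  (fun x => al * (x c * mon s (fun i => al * x i + be i)) +
            (be c * mon s (fun i => al * x i + be i) + 0)).
  by apply/funext => x; rewrite mon_cons addr0 mulrDl mulrA.
rewrite lL lL linf0// addr0 (IH L lL); last by move=> s' s's; rewrite L0// ltnS ltnW.
rewrite L0 ?ltnSn// !scaler0 addr0.
(* The term with the factor [x c] falls under the induction hypothesis for the functional
   [f |-> L (x c * f)], which kills degrees below [size s]. *)
rewrite (IH (fun f => L (fun x => x c * f x))); first last.
- move=> s' s's; rewrite -[RHS](L0 (c :: s'))//; congr L.
  by apply/funext => x; rewrite mon_cons.
- move=> e f g; rewrite -lL; congr L; apply/funext => x.
  by rewrite mulrDr mulrCA.
rewrite scalerA -exprS; congr (_ *: L _).
by apply/funext => x; rewrite mon_cons.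
Qed.

End AffineMoments.

Section Transition.
Variables (R : realType) (d : nat).
Local Notation C := R[i].
Local Notation T := 'rV[int]_d.
Local Notation fseq := (fseq R d).

Definition trans (r M : nat) (a : fseq r r) (g : T) (w : fseq r 1) : fseq r 1 :=
  fun k => M%:R ^+ d *: conv a w (M%:Z *: k + g).

Definition cascade (r M : nat) (a : fseq r r) (n : nat) : fseq r r :=
  iter n (subdivision M a) (@deltaI R d r).

Lemma dilate_can (M : nat) (g : T) : (0 < M)%N ->
  cancel (fun k : T => M%:Z *: k + g) (fun l => \row_i ((l - g)%R 0%R i %/ M%:Z)%Z).
Proof.
move=> M0 k; apply/rowP => i; rewrite !mxE addrK mulKz//.
by rewrite eqz_nat -lt0n.
Qed.

Lemma l0_dilate r t M (u : fseq r t) g : (0 < M)%N -> l0 u ->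
  l0 (fun k => u (M%:Z *: k + g)).
Proof. by move=> M0; apply: finsupp_can; exact: dilate_can. Qed.

Lemma l0_scale r t (u : fseq r t) c : l0 u -> l0 (fun k => c *: u k).
Proof.
by move=> /finsuppP[X [_ u0]]; apply: (@seq_finsupp _ _ X) => k /u0 ->; rewrite scaler0.
Qed.

Lemma l0_trans r M a g w : (0 < M)%N -> l0 a -> l0 w -> l0 (@trans r M a g w).
Proof.
by move=> M0 ha hw; apply: l0_scale; apply: l0_dilate => //; exact: l0_conv.
Qed.

Lemma l0_deltaI r : l0 (@deltaI R d r).
Proof.
apply: (@seq_finsupp _ _ [:: 0]) => k; rewrite inE /deltaI /delta => /negPf ->.
by rewrite scale0r.
Qed.

Lemma l0_subdivision r M (a v : fseq r r) : l0 a -> l0 v -> l0 (subdivision M a v).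
Proof.
move=> /finsuppP[Y [_ a0]] /finsuppP[X [_ v0]]; apply: l0_scale.
apply: (@seq_finsupp _ _ [seq M%:Z *: x + z | x <- X, z <- Y]) => k kXY.
apply: fsum0 => x; have [xX|/v0->] := boolP (x \in X); last by rewrite mul0mx.
rewrite a0 ?mulmx0//; apply: contra kXY => kz.
by apply/allpairsP; exists (x, k - M%:Z *: x); rewrite xX kz/= addrC subrK.
Qed.

Lemma l0_cascade r M (a : fseq r r) n : l0 a -> l0 (cascade M a n).
Proof.
move=> ha; elim: n => [|n IH]; first exact: l0_deltaI.
exact: l0_subdivision.
Qed.

Lemma convC_index r t q (y : fseq r t) (u : fseq t q) k :
  conv y u k = \sum_(x \in [set: T]) y (k - x) *m u x.
Proof.
have bij : bijective (fun x : T => k - x).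
  by exists (fun x => k - x) => x; rewrite subKr.
apply: (etrans (reindex_fsbigT _ _ bij)).
by apply: eq_fsum => x; rewrite subKr.
Qed.

(** Both sides are sums of [A_n(x) a(z) w(M (k - x) + g - z)], after replacing [z] by [z + M x] on
    the left. *)
Lemma cascade_trans r M (a : fseq r r) (w : fseq r 1) n g k : (0 < M)%N ->
  l0 a -> l0 w ->
  conv (cascade M a n.+1) w (M%:Z *: k + g) = conv (cascade M a n) (trans M a g w) k.
Proof.
move=> M0 ha hw; rewrite /cascade iterS -/(cascade M a n).
have /finsuppP[X [uX A0]] := l0_cascade M n ha.
set A := cascade M a n in A0 *.
have afin (x : T) : finsupp (fun z => a (z - M%:Z *: x)).
  apply: (finsupp_can (h' := fun z => z + M%:Z *: x) _ ha) => z /=.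
  by rewrite subrK.
pose F x z : 'M[C]_(r, 1) :=
  M%:R ^+ d *: (A x *m a (z - M%:Z *: x) *m w (M%:Z *: k + g - z)).
transitivity (\sum_(z \in [set: T]) \sum_(x <- X) F x z).
  apply: eq_fsum => z; rewrite /subdivision (fsumE X)//; last first.
    by move=> x /A0 ->; rewrite mul0mx.
  by rewrite -scalemxAl mulmx_suml scaler_sumr.
rewrite fsum_sum; last first.
  move=> x; have /finsuppP[Z [_ Z0]] := afin x.
  by apply: (@seq_finsupp _ _ Z) => z /Z0; rewrite /F => ->; rewrite mulmx0 mul0mx scaler0.
rewrite [RHS](fsumE X)//; last by move=> x /A0 ->; rewrite mul0mx.
apply: eq_bigr => x _; rewrite /trans -scalemxAr.
have a_fin : finsupp (fun z => a z *m w (M%:Z *: (k - x) + g - z)).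
  have /finsuppP[Z [_ Z0]] := ha.
  by apply: (@seq_finsupp _ _ Z) => z /Z0 ->; rewrite mul0mx.
apply: (etrans (fsum_shift _ (M%:Z *: x))).
rewrite /Defs.conv (raddf_fsum (mulmx (A x)))//.
apply: esym; apply: etrans.
  apply: (raddf_fsum (GRing.scale _)).
  have /finsuppP[Z [_ Z0]] := a_fin.
  by apply: (@seq_finsupp _ _ Z) => z /Z0 /= ->; rewrite mulmx0.
apply: eq_fsum => z; rewrite /F addrK -mulmxA; congr (_ *: (_ *m (_ *m w _))).
by apply/rowP => i; rewrite !mxE; ring.
Qed.

(* With [L1] and [L2] the two sides of the sum rules, [L1 - L2] kills all monomials
   of degree < j, hence also their pullbacks by [x |-> (x - g) / M]. *)
Lemma sum_rules_affine r M j (a : fseq r r) (y : fseq 1 r) (g : T) s :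
  (0 < M)%N -> l0 a -> l0 y -> matching_filter M a j y -> (size s < j)%N ->
  \sum_(k \in [set: T]) \sum_(x \in [set: T])
    mon s (zc (k + x)) *: (y k *m a (M%:Z *: x + g))
  = (M%:R ^+ d)^-1 *: \sum_(k \in [set: T])
      mon s (fun i => M%:R^-1 * zc k i - M%:R^-1 * zc g i) *: y k.
Proof.
move=> M0 ha hy hm sj; have MC : (M%:R : C) != 0 by rewrite pnatr_eq0 -lt0n.
have /finsuppP[X [uX y0]] := hy.
have /finsuppP[Y [uY a0]] := l0_dilate g M0 ha.
pose L1 (f : ('I_d -> C) -> C) := \sum_(k \in [set: T]) \sum_(x \in [set: T])
  f (zc (M%:Z *: k + (M%:Z *: x + g))) *: (y k *m a (M%:Z *: x + g)).
pose L2 (f : ('I_d -> C) -> C) := (M%:R ^+ d)^-1 *: \sum_(k \in [set: T]) f (zc k) *: y k.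
have lL : linf (fun f => L1 f - L2 f).
  apply: linfB; last apply: linfZ.
    apply: (@linf_fsum _ _ _ _ X) => [k|k f /y0 yk].
      apply: (@linf_fsum _ _ _ _ Y) => [x|x f /a0 ax]; first exact: linf_eval.
      by rewrite ax mulmx0 scaler0.
    by apply: fsum0 => x; rewrite yk mul0mx scaler0.
  apply: (@linf_fsum _ _ _ _ X) => [k|k f /y0 yk]; first exact: linf_eval.
  by rewrite yk scaler0.
have L0 s' : (size s' < j)%N -> L1 (mon s') - L2 (mon s') = 0.
  by move=> s'j; rewrite /L1 (sum_rules M0 ha hy hm)// subrr.
have := @affine_mom _ _ _ M%:R^-1 (fun i => - (M%:R^-1 * zc g i)) s _ lL
  (fun s' s's => L0 s' (ltn_trans s's sj)).
rewrite L0// scaler0 => /eqP; rewrite subr_eq0 => /eqP E; apply: etrans E.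
apply: eq_fsum => k; apply: eq_fsum => x; congr (mon s _ *: _).
apply/funext => i; rewrite /zc !mxE !intrD !intrM.
by rewrite -[(M%:Z)%:~R]pmulrn; field.
Qed.

(** The sum rules for the offset [g - x], with [x] an index of [w], cancel the factor [M^d] and turn
    the left side into the [s]-moment of [y * w] pulled back by [z |-> (z - g) / M]. Since the
    moments of [y * w] below degree [n] vanish, only the leading term of the pullback remains. *)
Lemma mom_conv_trans r M j n (a : fseq r r) (y : fseq 1 r) (w : fseq r 1) (g : T) s :
  (0 < M)%N -> l0 a -> l0 y -> matching_filter M a j y -> (n < j)%N ->
  Vspace n y w -> (size s <= n)%N ->
  mom s (conv y (trans M a g w)) = M%:R ^- size s *: mom s (conv y w).
Proof.
move=> M0 ha hy hm nj /(VspaceP _ _ hy)[hw w0] sn.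
have MC : (M%:R : C) != 0 by rewrite pnatr_eq0 -lt0n.
have hT := l0_trans g M0 ha hw.
have /finsuppP[X [uX y0]] := hy; have /finsuppP[Y [uY w0']] := hw.
have afin x := l0_dilate (g - x) M0 ha.
apply: (etrans (fsum_conv _ hy hT)).
transitivity (\sum_(x <- Y) M%:R ^+ d *: ((\sum_(k \in [set: T]) \sum_(l \in [set: T])
   mon s (zc (k + l)) *: (y k *m a (M%:Z *: l + (g - x)))) *m w x)).
  pose H k x l : 'M[C]_(1, 1) :=
    M%:R ^+ d *: (mon s (zc (k + l)) *: (y k *m a (M%:Z *: l + (g - x))) *m w x).
  have Hfin k x : finsupp (H k x).
    have /finsuppP[Z [_ Z0]] := afin x.
    apply: (@seq_finsupp _ _ Z) => l /Z0; rewrite /H => ->.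
    by rewrite mulmx0 scaler0 mul0mx scaler0.
  transitivity (\sum_(k <- X) \sum_(x <- Y) \sum_(l \in [set: T]) H k x l).
    rewrite (fsumE X)//; last first.
      by move=> k /y0 yk; apply: fsum0 => l; rewrite yk mul0mx scaler0.
    apply: eq_bigr => k _; rewrite -fsum_sum//; apply: eq_fsum => l.
    rewrite /trans convC_index (fsumE Y)//; last by move=> x /w0' ->; rewrite mulmx0.
    rewrite -scalemxAr mulmx_sumr scalerA mulrC -scalerA !scaler_sumr.
    apply: eq_bigr => x _; rewrite /H -scalemxAl mulmxA addrA.
    by rewrite !scalerA.
  rewrite exchange_big; apply: eq_bigr => x _.
  rewrite (fsumE X)//; last first.
    by move=> k /y0 yk; apply: fsum0 => l; rewrite yk mul0mx scaler0.
  rewrite mulmx_suml scaler_sumr; apply: eq_bigr => k _.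
  have /finsuppP[Z [uZ Z0]] := afin x.
  rewrite (fsumE Z)//; last by move=> l /Z0; rewrite /H => ->;
    rewrite mulmx0 scaler0 mul0mx scaler0.
  rewrite (fsumE Z)//; last by move=> l /Z0 ->; rewrite mulmx0 scaler0.
  by rewrite mulmx_suml scaler_sumr.
pose L (f : ('I_d -> C) -> C) :=
  \sum_(k \in [set: T]) \sum_(l \in [set: T]) f (zc (k + l)) *: (y k *m w l).
have lL : linf L.
  apply: (@linf_fsum _ _ _ _ X) => [k|k f /y0 yk].
    apply: (@linf_fsum _ _ _ _ Y) => [x|x f /w0' ax]; first exact: linf_eval.
    by rewrite ax mulmx0 scaler0.
  by apply: fsum0 => x; rewrite yk mul0mx scaler0.
have LE s' : L (mon s') = mom s' (conv y w) by rewrite /mom fsum_conv.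
transitivity (L (fun z => mon s (fun i => M%:R^-1 * z i + - (M%:R^-1 * zc g i)))); last first.
  rewrite (affine_mom _ _ lL) => [|s' s's]; first by rewrite LE exprVn.
  by rewrite LE w0// (leq_trans s's).
apply: esym; apply: (etrans (fsum2E
  (fun k l => mon s (fun i => M%:R^-1 * zc (k + l) i + - (M%:R^-1 * zc g i))) uX uY y0 w0')).
rewrite exchange_big; apply: eq_bigr => x _.
rewrite (sum_rules_affine (g - x) M0 ha hy hm (leq_ltn_trans sn nj)).
rewrite -scalemxAl scalerA divff ?expf_neq0// scale1r.
rewrite (fsumE X)//; last by move=> k /y0 ->; rewrite scaler0.
rewrite mulmx_suml; apply: eq_bigr => k _; rewrite -scalemxAl; congr (mon s _ *: _).
by apply/funext => i; rewrite /zc !mxE !intrD intrN; ring.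
Qed.

Lemma convB r t q (y : fseq r t) (u v : fseq t q) c : l0 y ->
  conv y (fun k => u k - c *: v k) = (fun k => conv y u k - c *: conv y v k).
Proof.
move=> /finsuppP[X [uX y0]]; apply/funext => k.
have E (w : fseq t q) : conv y w k = \sum_(x <- X) y x *m w (k - x).
  by apply: fsumE => // x /y0 ->; rewrite mul0mx.
rewrite !E scaler_sumr -sumrB.
by apply: eq_bigr => x _; rewrite mulmxBr scalemxAr.
Qed.

Lemma l0B r t (u v : fseq r t) c : l0 u -> l0 v -> l0 (fun k => u k - c *: v k).
Proof.
move=> hu hv; have := finsuppD hu (l0_scale (- c) hv).
by congr finite_set; apply/seteqP; split => k /=; rewrite scaleNr.
Qed.

Lemma momB r t s (u v : fseq r t) c : l0 u -> l0 v ->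
  mom s (fun k => u k - c *: v k) = mom s u - c *: mom s v.
Proof.
move=> /finsuppP[X [uX u0]] /finsuppP[Y [uY v0]].
have X0 k : k \notin undup (X ++ Y) -> u k = 0 /\ v k = 0.
  by rewrite mem_undup mem_cat negb_or => /andP[/u0-> /v0->].
have E (w : fseq r t) : (forall k, k \notin undup (X ++ Y) -> w k = 0) ->
    mom s w = \sum_(k <- undup (X ++ Y)) mon s (zc k) *: w k.
  by apply: momE; exact: undup_uniq.
have uE := E u (fun k kXY => (X0 k kXY).1).
have vE := E v (fun k kXY => (X0 k kXY).2).
rewrite uE vE E; last by move=> k /X0[-> ->]; rewrite scaler0 subrr.
rewrite scaler_sumr -sumrB; apply: eq_bigr => k _.
by rewrite scalerBr !scalerA [c * _]mulrC.
Qed.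

(** In degree [n] the two moments cancel exactly; below degree [n] both vanish. *)
Lemma Vspace_trans r M j n (a : fseq r r) (y : fseq 1 r) (w : fseq r 1) (g : T) :
  (0 < M)%N -> l0 a -> l0 y -> matching_filter M a j y -> (n < j)%N ->
  Vspace n y w -> Vspace n.+1 y (fun k => trans M a g w k - M%:R ^- n *: w k).
Proof.
move=> M0 ha hy hm nj hV; have [hw w0] := (VspaceP _ _ hy).1 hV.
have hT := l0_trans g M0 ha hw.
apply/(VspaceP _ _ hy); split=> [|s]; first exact: l0B.
rewrite ltnS => sn; rewrite convB// momB; try exact: l0_conv.
rewrite (mom_conv_trans _ M0 ha hy hm nj hV)//.
move: sn; rewrite leq_eqVlt => /predU1P[->|sn]; first by rewrite subrr.
by rewrite w0// !scaler0 subrr.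
Qed.

End Transition.

(** * The l_p norms *)

Section ScalarNorms.
Variables (R : realType) (d : nat).
Local Notation C := R[i].
Local Notation T := 'rV[int]_d.
Implicit Types (u v : T -> C) (X : seq T) (q : R) (p : \bar R).

Lemma normc_ge0 (z : C) : 0 <= normc z.
Proof. by case: z => x y; exact: sqrtr_ge0. Qed.

Lemma powR_le_inv (x B q : R) : 0 < q -> 0 <= x -> 0 <= B ->
  (x `^ q^-1 <= B) = (x <= B `^ q).
Proof.
move=> q0 x0 B0; apply/idP/idP => H.
  have := ge0_ler_powR (ltW q0) (_ : _ \in Num.nneg) (_ : _ \in Num.nneg) H.
  by rewrite -powRrM mulVf ?gt_eqF// powRr1//; apply; rewrite nnegrE ?powR_ge0.
have q0' : 0 <= q^-1 by rewrite invr_ge0 ltW.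
have := ge0_ler_powR q0' (_ : _ \in Num.nneg) (_ : _ \in Num.nneg) H.
by rewrite -powRrM mulfV ?gt_eqF// powRr1//; apply; rewrite nnegrE ?powR_ge0.
Qed.

Lemma lp_norm1E q u X : 1 <= q -> uniq X -> (forall k, k \notin X -> u k = 0) ->
  lp_norm1 q%:E u = ((\sum_(k <- X) normc (u k) `^ q) `^ q^-1)%:E.
Proof.
move=> q1 uX u0; have q0 : q != 0 by rewrite gt_eqF// (lt_le_trans ltr01).
rewrite /lp_norm1 -poweR_EFin; congr (_ `^ _)%E.
transitivity (\esum_(k in [set` X]) (normc (u k) `^ q)%:E)%E.
  rewrite [RHS]esum_mkcond; apply: eq_esum => k _.
  by rewrite mem_setE; case: ifPn => // /u0 ->; rewrite ComplexField.Normc.normc0 powR0.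
rewrite esum_fset; [|exact: finite_seq|by move=> k _; rewrite lee_fin powR_ge0].
by rewrite -fsbig_seq// sumEFin.
Qed.

(** Without the root, a norm bound becomes a bound on a finite sum of powers, the form in which the
    inequalities below are proved. *)
Lemma lp_norm1_le q u X B : 1 <= q -> 0 < B -> uniq X ->
  (forall k, k \notin X -> u k = 0) ->
  (lp_norm1 q%:E u <= B%:E)%E = (\sum_(k <- X) normc (u k) `^ q <= B `^ q).
Proof.
move=> q1 B0 uX u0; rewrite (lp_norm1E q1 uX u0) lee_fin powR_le_inv//; last exact: ltW.
  by rewrite (lt_le_trans ltr01).
by apply: sumr_ge0 => k _; exact: powR_ge0.
Qed.

Lemma lp_norm1y_le u B : (lp_norm1 +oo%E u <= B%:E)%E <-> forall k, normc (u k) <= B.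
Proof.
split=> [H k|H].
  by rewrite -lee_fin; apply: le_trans H; apply: ereal_sup_ubound; exists k.
by apply: ge_ereal_sup => _ [k _ <-]; rewrite lee_fin.
Qed.

Lemma lp_norm1_ge0 p u : (1%:E <= p)%E -> (0 <= lp_norm1 p u)%E.
Proof.
case: p => [q _||]; last by [].
  exact: poweR_ge0.
move=> _; apply: (@le_trans _ _ (normc (u 0))%:E); first by rewrite lee_fin normc_ge0.
by apply: ereal_sup_ubound; exists 0.
Qed.

Lemma lp_norm1_fin p u : (1%:E <= p)%E -> finsupp u -> lp_norm1 p u \is a fin_num.
Proof.
move=> p1 /finsuppP[X [uX u0]]; case: p p1 => [q q1||]; last by [].
  by rewrite (lp_norm1E q1 uX u0).
move=> p1; rewrite ge0_fin_numE ?lp_norm1_ge0//.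
apply: (@le_lt_trans _ _ (\sum_(k <- X) normc (u k))%:E); last exact: ltry.
apply/lp_norm1y_le => k; have [kX|/u0 ->] := boolP (k \in X); last first.
  by rewrite ComplexField.Normc.normc0; apply: sumr_ge0 => *; exact: normc_ge0.
rewrite (big_rem k)//= lerDl; apply: sumr_ge0 => *; exact: normc_ge0.
Qed.

Lemma powR_divr (x S q : R) : 0 <= x -> 0 < S -> (x / S) `^ q = x `^ q / S `^ q.
Proof.
move=> x0 S0; have Sq : S `^ q != 0 by rewrite gt_eqF// powR_gt0.
apply: (mulIf Sq); rewrite divfK// -powRM ?divr_ge0// ?ltW//.
by rewrite divfK// gt_eqF.
Qed.

(** The left quotient is the convex combination of [x / A] and [y / B] with weights [A / (A + B)]
    and [B / (A + B)]; the power is convex. *)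
Lemma powR_convex_comb (x y A B q : R) : 1 <= q -> 0 <= x -> 0 <= y -> 0 < A -> 0 < B ->
  ((x + y) / (A + B)) `^ q <=
  A / (A + B) * (x / A) `^ q + B / (A + B) * (y / B) `^ q.
Proof.
move=> q1 x0 y0 A0 B0; have AB0 : 0 < A + B by rewrite addr_gt0.
pose t := A / (A + B).
have t0 : 0 <= t by rewrite divr_ge0 ?ltW.
have t1 : t <= 1 by rewrite ler_pdivrMr// mul1r lerDl ltW.
have tB : B / (A + B) = (1 - t).
  by rewrite /t; field; rewrite gt_eqF.
have xyAB : (x + y) / (A + B) = t * (x / A) + (1 - t) * (y / B).
  by rewrite -tB /t; field; rewrite !gt_eqF.
rewrite xyAB tB -/t.
have := @convex_powR R q q1 (Itv01 t0 t1) (x / A) (y / B).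
have xA : 0 <= x / A by rewrite divr_ge0// ltW.
have yB : 0 <= y / B by rewrite divr_ge0// ltW.
rewrite !inE/= !in_itv/= !andbT xA yB => /(_ isT isT).
by rewrite !convRE.
Qed.

(** Minkowski's inequality: after normalising by [A] and [B], sum the convexity estimate over the
    index. *)
Lemma powR_minkowski (I : Type) (X : seq I) (f g : I -> R) (A B q : R) : 1 <= q ->
  (forall i, 0 <= f i) -> (forall i, 0 <= g i) -> 0 < A -> 0 < B ->
  \sum_(i <- X) f i `^ q <= A `^ q -> \sum_(i <- X) g i `^ q <= B `^ q ->
  \sum_(i <- X) (f i + g i) `^ q <= (A + B) `^ q.
Proof.
move=> q1 f0 g0 A0 B0 fA gB; have AB0 : 0 < A + B by rewrite addr_gt0.
have scale (h : I -> R) S : (forall i, 0 <= h i) -> 0 < S ->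
    (\sum_(i <- X) h i `^ q <= S `^ q) = (\sum_(i <- X) (h i / S) `^ q <= 1).
  move=> h0 S0; under [in RHS]eq_bigr do rewrite powR_divr//.
  by rewrite -mulr_suml ler_pdivrMr ?powR_gt0// mul1r.
have fg0 i : 0 <= f i + g i by rewrite addr_ge0.
rewrite scale//; rewrite scale// in fA; rewrite scale// in gB.
apply: (@le_trans _ _ (\sum_(i <- X) (A / (A + B) * (f i / A) `^ q +
                                     B / (A + B) * (g i / B) `^ q))).
  by apply: ler_sum => i _; exact: powR_convex_comb.
rewrite big_split/= -!mulr_sumr.
have -> : 1 = A / (A + B) * 1 + B / (A + B) * 1 :> R by field; rewrite gt_eqF.
by apply: lerD; rewrite ler_pM2l ?divr_gt0.
Qed.

(** The triangle inequality is stated for positive upper bounds because the normalisation divides by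
    them. Callers enlarge a possibly zero norm by a small amount. *)
Lemma lp_norm1D p u v (A B : R) : (1%:E <= p)%E -> finsupp u -> finsupp v ->
  0 < A -> 0 < B -> (lp_norm1 p u <= A%:E)%E -> (lp_norm1 p v <= B%:E)%E ->
  (lp_norm1 p (fun k => u k + v k)%R <= (A + B)%R%:E)%E.
Proof.
move=> p1 hu hv A0 B0; case: p p1 => [q q1||]; last by [].
  have /finsuppP[X [uX u0]] := hu; have /finsuppP[Y [uY v0]] := hv.
  have XY k : k \notin undup (X ++ Y) -> u k = 0 /\ v k = 0.
    by rewrite mem_undup mem_cat negb_or => /andP[/u0-> /v0->].
  have E w D : 0 < D -> (forall k, k \notin undup (X ++ Y) -> w k = 0) ->
      (lp_norm1 q%:E w <= D%:E)%E =
      (\sum_(k <- undup (X ++ Y)) normc (w k) `^ q <= D `^ q).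
    by move=> D0; apply: lp_norm1_le => //; exact: undup_uniq.
  have uE := E u A A0 (fun k kXY => (XY k kXY).1).
  have vE := E v B B0 (fun k kXY => (XY k kXY).2).
  rewrite uE vE E ?addr_gt0//; last by move=> k /XY[-> ->]; rewrite addr0.
  move=> uA vB; apply: le_trans (powR_minkowski q1 _ _ A0 B0 uA vB);
    try by move=> k; exact: normc_ge0.
  apply: ler_sum => k _; apply: ge0_ler_powR; rewrite ?nnegrE ?addr_ge0 ?normc_ge0//.
    by rewrite (le_trans ler01).
  exact: le_normcD.
move=> _ /lp_norm1y_le uA /lp_norm1y_le vB; apply/lp_norm1y_le => k.
by apply: le_trans (le_normcD _ _) _; exact: lerD.
Qed.

Lemma lp_norm1Z p u (c : C) (A : R) : (1%:E <= p)%E -> finsupp u -> 0 < A -> 0 < normc c ->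
  (lp_norm1 p u <= A%:E)%E -> (lp_norm1 p (fun k => c * u k)%R <= (normc c * A)%R%:E)%E.
Proof.
move=> p1 hu A0 c0; case: p p1 => [q q1||]; last by [].
  have /finsuppP[X [uX u0]] := hu.
  rewrite (lp_norm1_le q1 A0 uX u0) (lp_norm1_le (X := X) q1)//; first last.
  - by move=> k /u0 ->; rewrite mulr0.
  - exact: mulr_gt0.
  move=> uA; rewrite powRM ?(ltW A0) ?(ltW c0)//.
  under eq_bigr do rewrite ComplexField.Normc.normcM powRM ?normc_ge0//.
  by rewrite -mulr_sumr ler_pM2l ?powR_gt0.
move=> _ /lp_norm1y_le uA; apply/lp_norm1y_le => k.
by rewrite ComplexField.Normc.normcM ler_pM2l.
Qed.

Definition inv_exp p : R := match p with q%:E => q^-1 | _ => 0 end.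

(** Hoelder's inequality against the constant 1, up to a factor 2 which is harmless under [n]-th
    roots. *)
Lemma sum_normc_le p u (A : R) (X : seq T) (N : nat) : (1%:E <= p)%E -> 0 < A ->
  uniq X -> (forall k, k \notin X -> u k = 0) -> (size X <= N)%N -> (0 < N)%N ->
  (lp_norm1 p u <= A%:E)%E ->
  \sum_(k <- X) normc (u k) <= 2 * A * N%:R `^ (1 - inv_exp p).
Proof.
move=> p1 A0 uX u0 XN N0; have NR : 0 < N%:R :> R by rewrite ltr0n.
have szX : (size X)%:R <= N%:R :> R by rewrite ler_nat.
case: p p1 => [q||]; last by []; last first.
  move=> _ /lp_norm1y_le uA; rewrite subr0 powRr1 ?(ltW NR)//.
  apply: (@le_trans _ _ (\sum_(k <- X) A)); first exact: ler_sum.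
  rewrite big_const_seq count_predT iter_addr_0 -mulr_natl.
  have : (size X)%:R * A <= N%:R * A by rewrite ler_pM2r.
  by have := mulr_gt0 NR A0; lra.
rewrite lee_fin => q1; rewrite (lp_norm1_le q1 A0 uX u0) => uA.
have q0 : 0 < q by rewrite (lt_le_trans ltr01).
(* The threshold balances the two contributions: at most [N] values below [l] sum to at most
   [N * l], and a value [x] above [l] is at most [l^(1-q) x^q]. Both totals are bounded by
   [A N^(1 - 1/q)]. *)
pose l := A * N%:R `^ (- q^-1).
have l0 : 0 < l by rewrite mulr_gt0// powR_gt0.
have H x : 0 <= x -> x <= l + l `^ (1 - q) * x `^ q.
  move=> x0; have [xl|lx] := leP x l.
    by rewrite (le_trans xl)// lerDl mulr_ge0 ?powR_ge0.
  apply: (@le_trans _ _ (l `^ (1 - q) * x `^ q)); last by rewrite lerDr ltW.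
  have x0' : 0 < x by rewrite (lt_trans l0).
  have -> : x `^ q = x * x `^ (q - 1) by rewrite mulr_powRB1.
  have lq : l `^ (1 - q) = (l `^ (q - 1))^-1 by rewrite -powRN opprB.
  rewrite lq mulrCA ler_peMr// mulrC ler_pdivlMr ?powR_gt0// mul1r.
  by apply: ge0_ler_powR; rewrite ?nnegrE ?subr_ge0//; exact: ltW.
apply: (@le_trans _ _ (\sum_(k <- X) (l + l `^ (1 - q) * normc (u k) `^ q))).
  by apply: ler_sum => k _; apply: H; exact: normc_ge0.
rewrite big_split/= big_const_seq count_predT iter_addr_0 -[l *+ _]mulr_natl -mulr_sumr.
have -> : 2 * A * N%:R `^ (1 - q^-1) = N%:R * l + l `^ (1 - q) * A `^ q.
  have Nn0 : N%:R != 0 :> R by rewrite gt_eqF.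
  have An0 : A != 0 by rewrite gt_eqF.
  have E1 : N%:R * l = A * N%:R `^ (1 - q^-1).
    by rewrite /l mulrCA powRD ?Nn0 ?implybT// powRr1// ltW.
  have E2 : l `^ (1 - q) * A `^ q = A * N%:R `^ (1 - q^-1).
    rewrite /l powRM ?powR_ge0 ?(ltW A0)// -powRrM mulrAC -powRD ?An0 ?implybT//.
    rewrite subrK powRr1 ?(ltW A0)//.
    by congr (_ * _ `^ _); field; rewrite gt_eqF.
  by rewrite E1 E2; ring.
apply: lerD; first by rewrite ler_pM2r.
by rewrite ler_pM2l// powR_gt0.
Qed.

End ScalarNorms.

(** * Norms and cosets of the dilated lattice *)

Section Cosets.
Variables (R : realType) (d : nat).
Local Notation C := R[i].
Local Notation T := 'rV[int]_d.
Implicit Types (p : \bar R).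

Definition coset_rep (M : nat) (z : {ffun 'I_d -> 'I_M}) : T := \row_i (z i : int).

Definition coset_quo (M : nat) (x : T) : T := \row_i (x 0%R i %/ M%:Z)%Z.

Lemma coset_rep_div (M : nat) (z : {ffun 'I_d -> 'I_M}) (k : T) i : (0 < M)%N ->
  ((M%:Z *: k + coset_rep z)%R 0%R i %/ M%:Z)%Z = k 0 i.
Proof.
move=> M0; rewrite !mxE mulrC divzMDl ?eqz_nat -?lt0n// divz_small ?addr0//.
by rewrite lez_nat ltz_nat ltn_ord.
Qed.

Lemma coset_rep_inj (M : nat) : (0 < M)%N ->
  injective (fun x : T * {ffun 'I_d -> 'I_M} => M%:Z *: x.1 + coset_rep x.2).
Proof.
move=> M0 [k z] [k' z'] /= E.
have kk' : k = k'.
  by apply/rowP => i; rewrite -(coset_rep_div z k i M0) E coset_rep_div.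
congr pair => //; apply/ffunP => i; apply/val_inj/eqP; rewrite -eqz_nat; apply/eqP.
by move: E; rewrite kk' => /addrI/rowP/(_ i); rewrite !mxE.
Qed.

Lemma coset_decomposition (M : nat) (x : T) : (0 < M)%N ->
  exists z : {ffun 'I_d -> 'I_M},
    x = M%:Z *: coset_quo M x + coset_rep z.
Proof.
move=> M0; have xM i : (`|(x 0%R i %% M%:Z)%Z| < M)%N.
  by rewrite -ltz_nat gez0_abs ?ltz_pmod// modz_ge0// eqz_nat -lt0n.
exists [ffun i => Ordinal (xM i)]; apply/rowP => i; rewrite !mxE ffunE /=.
rewrite gez0_abs ?modz_ge0 ?eqz_nat -?lt0n//.
by rewrite mulrC -divz_eq.
Qed.

Definition dim_over p : R := d%:R * inv_exp p.

(** For finite [q] the [q]-th powers over the [M^d] cosets add up to at most [M^d B^q]; for the sup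
    norm there is no loss, in accordance with [dim_over] being 0. *)
Lemma lp_norm1_coset p (M : nat) (u : T -> C) (B : R) : (0 < M)%N -> (1%:E <= p)%E ->
  finsupp u -> 0 < B ->
  (forall z : {ffun 'I_d -> 'I_M},
    lp_norm1 p (fun k => u (M%:Z *: k + coset_rep z)%R) <= B%:E)%E ->
  (lp_norm1 p u <= (M%:R `^ dim_over p * B)%R%:E)%E.
Proof.
move=> M0 p1 hu B0 H; have MR : 0 < M%:R :> R by rewrite ltr0n.
have /finsuppP[X [uX u0]] := hu.
case: p p1 H => [q||]; last by []; last first.
  move=> _ H; rewrite /dim_over mulr0 powRr0 mul1r; apply/lp_norm1y_le => x.
  have [z ->] := coset_decomposition x M0.
  by have /lp_norm1y_le := H z; apply.
rewrite lee_fin => q1 H.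
pose Y := undup [seq coset_quo M x | x <- X].
have uY : uniq Y by exact: undup_uniq.
have Y0 (z : {ffun 'I_d -> 'I_M}) k : k \notin Y -> u (M%:Z *: k + coset_rep z) = 0.
  move=> kY; apply: u0; apply: contra kY => kX; rewrite mem_undup.
  apply/mapP; exists (M%:Z *: k + coset_rep z) => //; apply/rowP => i.
  by rewrite mxE coset_rep_div.
pose S := [seq M%:Z *: k + coset_rep z | k <- Y, z <- enum {ffun 'I_d -> 'I_M}].
have uS : uniq S.
  apply: allpairs_uniq => //; first exact: enum_uniq.
  by move=> [k z] [k' z'] _ _; exact: (@coset_rep_inj M M0 (k, z) (k', z')).
have S0 x : x \notin S -> u x = 0.
  have [z E] := coset_decomposition x M0; rewrite {2}E => xS; apply: Y0.
  apply: contra xS => kY; apply/allpairsP; exists (coset_quo M x, z).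
  by rewrite mem_enum.
rewrite (lp_norm1_le q1 _ uS S0) ?mulr_gt0 ?powR_gt0//.
rewrite big_allpairs_dep exchange_big/=.
apply: (@le_trans _ _ (\sum_(z <- enum {ffun 'I_d -> 'I_M}) B `^ q)).
  by apply: ler_sum => z _; rewrite -(lp_norm1_le q1 B0 uY (Y0 z)).
rewrite big_const_seq count_predT iter_addr_0 -cardE card_ffun !card_ord.
rewrite powRM ?powR_ge0 ?(ltW B0)// -powRrM /dim_over -mulrA mulVf ?mulr1; last first.
  by rewrite gt_eqF// (lt_le_trans ltr01).
by rewrite powR_mulrn ?(ltW MR)// -natrX mulr_natl.
Qed.

End Cosets.

(** * Real-valued norms of vector sequences *)

Section VectorNorms.
Variables (R : realType) (d r : nat) (p : \bar R).
Hypothesis p1 : (1%:E <= p)%E.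
Local Notation C := R[i].
Local Notation T := 'rV[int]_d.
Implicit Types (u v F : fseq R d r 1).

Lemma finsupp_entry u i : l0 u -> finsupp (fun k => u k i 0).
Proof.
by move=> /finsuppP[X [uX u0]]; apply: (@seq_finsupp _ _ X) => k /u0 ->; rewrite mxE.
Qed.

Definition nrm1 u (i : 'I_r) : R := fine (lp_norm1 p (fun k => u k i 0)).
Definition nrm u : R := \sum_i nrm1 u i.

Lemma nrm1_ge0 u i : 0 <= nrm1 u i.
Proof. by apply: fine_ge0; exact: lp_norm1_ge0. Qed.

Lemma nrm_ge0 u : 0 <= nrm u.
Proof. by apply: sumr_ge0 => i _; exact: nrm1_ge0. Qed.

Lemma nrm1E u i : l0 u -> lp_norm1 p (fun k => u k i 0) = (nrm1 u i)%:E.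
Proof. by move=> hu; rewrite fineK//; apply: lp_norm1_fin => //; exact: finsupp_entry. Qed.

Lemma nrmE u : l0 u -> lp_norm p u = (nrm u)%:E.
Proof.
move=> hu; rewrite /lp_norm /nrm -sumEFin; apply: eq_bigr => i _.
by rewrite big_ord1 nrm1E.
Qed.

Lemma nrm1_le_nrm u i : nrm1 u i <= nrm u.
Proof.
by rewrite /nrm (bigD1 i)//= lerDl; apply: sumr_ge0 => j _; exact: nrm1_ge0.
Qed.

(** On each coset apply the triangle inequality entrywise, then assemble the cosets. The remainder
    on one coset is bounded by the sum over all of them, so the bound is uniform in [z]. *)
Lemma nrm_coset (M : nat) (c : C) F' F (G : {ffun 'I_d -> 'I_M} -> fseq R d r 1) :
  (0 < M)%N -> 0 < normc c -> l0 F' -> l0 F -> (forall z, l0 (G z)) ->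
  (forall k z, F' (M%:Z *: k + coset_rep z) = c *: F k + G z k) ->
  nrm F' <= M%:R `^ dim_over d p * (normc c * nrm F + \sum_z nrm (G z)).
Proof.
move=> M0 c0 hF' hF hG FG.
have Mp : 0 < M%:R `^ dim_over d p :> R by rewrite powR_gt0// ltr0n.
rewrite /nrm exchange_big/= mulr_sumr -big_split/= mulr_sumr; apply: ler_sum => i _.
apply/ler_addgt0Pr => e e0.
(* Positive slack for the two bounds, scaled so that the total excess is exactly [e]. *)
pose e' := e / (M%:R `^ dim_over d p * (normc c + 1)).
have e'0 : 0 < e' by rewrite divr_gt0// mulr_gt0// addr_gt0.
pose B := normc c * (nrm1 F i + e') + (\sum_z nrm1 (G z) i + e').
have A1 : 0 < nrm1 F i + e' by rewrite ltr_wpDl// nrm1_ge0.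
have S0 : 0 <= \sum_z nrm1 (G z) i by apply: sumr_ge0 => z _; exact: nrm1_ge0.
have A2 : 0 < \sum_z nrm1 (G z) i + e' by rewrite ltr_wpDl.
have -> : M%:R `^ dim_over d p * (normc c * nrm1 F i + \sum_z nrm1 (G z) i) + e =
          M%:R `^ dim_over d p * B.
  by rewrite /B /e'; field; rewrite !gt_eqF// addr_gt0.
rewrite -lee_fin -nrm1E//; apply: lp_norm1_coset => //.
- exact: finsupp_entry.
- by rewrite addr_gt0// mulr_gt0.
move=> z.
have -> : (fun k => F' (M%:Z *: k + coset_rep z) i 0) =
          (fun k => c * F k i 0 + G z k i 0).
  by apply/funext => k; rewrite FG !mxE.
apply: lp_norm1D => //.
- have /finsuppP[X [uX u0]] := hF.
  by apply: (@seq_finsupp _ _ X) => k /u0 ->; rewrite mxE mulr0.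
- exact: finsupp_entry.
- exact: mulr_gt0.
- apply: lp_norm1Z => //; first exact: finsupp_entry.
  by rewrite nrm1E// lee_fin lerDl ltW.
rewrite nrm1E// lee_fin (bigD1 z)//= -addrA lerDl addr_ge0 ?(ltW e'0)//.
by apply: sumr_ge0 => z' _; exact: nrm1_ge0.
Qed.

End VectorNorms.

(** * Exponential growth rates *)

Section Growth.
Variable R : realType.
Implicit Types (x : nat -> \bar R) (b K : R).

Definition growth x : \bar R := limn_esup (fun n => (x n `^ n%:R^-1)%E).

Lemma growth_lt x b : 0 < b -> (forall n, 0 <= x n)%E -> (growth x < b%:E)%E ->
  exists n0, forall n, (n0 <= n)%N -> (x n <= (b ^+ n)%:E)%E.
Proof.
move=> b0 x0 /ereal_inf_lt[_ [A [n0 _ n0A] <-] Ab].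
(* The successor excludes [n = 0], where the exponent [n%:R^-1] is 0 and the root carries no
   information. *)
exists n0.+1 => n n0n; have n0' : (0 < n)%N by rewrite (leq_ltn_trans _ n0n).
have : (x n `^ n%:R^-1 <= b%:E)%E.
  apply: le_trans (ltW Ab); apply: ereal_sup_ubound; exists n => //.
  by apply: n0A => /=; exact: ltnW.
move: (x0 n); case: (x n) => [t t0| _|//].
  by rewrite poweR_EFin !lee_fin powR_le_inv ?ltr0n ?(ltW b0)// powR_mulrn// ltW.
by rewrite poweRyr ?invr_eq0 ?pnatr_eq0 -?lt0n// leye_eq.
Qed.

Lemma expr_eventually_le b b' K : 0 < b -> b < b' -> 0 < K ->
  exists n0, forall n, (n0 <= n)%N -> K * b ^+ n <= b' ^+ n.
Proof.
move=> b0 bb' K0; have b'0 : 0 < b' by rewrite (lt_trans b0).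
have z1 : `|b / b'| < 1 by rewrite gtr0_norm ?divr_gt0// ltr_pdivrMr// mul1r.
have /cvgr_lt /(_ _ ltr01)[n0 _ H] := cvg_geometric K z1.
exists n0 => n n0n; have /ltW := H n n0n.
by rewrite /geometric /= expr_div_n mulrA ler_pdivrMr ?exprn_gt0// mul1r.
Qed.

Lemma growth_le x b K n0 : 0 < b -> 0 < K -> (forall n, 0 <= x n)%E ->
  (forall n, (n0 <= n)%N -> (x n <= (K * b ^+ n)%:E)%E) -> (growth x <= b%:E)%E.
Proof.
move=> b0 K0 x0 H; apply/lee_addgt0Pr => e e0; rewrite -EFinD.
have be0 : 0 < b + e by rewrite addr_gt0.
have bbe : b < b + e by rewrite ltrDl.
have [n1 n1P] := expr_eventually_le b0 bbe K0.
pose N := maxn 1 (maxn n0 n1).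
apply: (@le_trans _ _ (ereal_sup
  ((fun n => (x n `^ n%:R^-1)%E) @` [set n | (N <= n)%N]))).
  apply: ereal_inf_lbound; exists [set n | (N <= n)%N] => //.
  by exists N.
apply: ge_ereal_sup => _ [n /= + <-]; rewrite !geq_max => /and3P[n_gt0 n0n n1n].
have := le_trans (H n n0n) (_ : _ <= ((b + e) ^+ n)%:E)%E.
rewrite lee_fin n1P// => /(_ isT).
move: (x0 n); case: (x n) => [t t0| _|//]; last by rewrite leye_eq.
by rewrite poweR_EFin !lee_fin => tb; rewrite powR_le_inv ?ltr0n ?(ltW be0)// powR_mulrn// ltW.
Qed.

Lemma growth_ge x b K : 0 < b -> 0 < K -> (forall n, 0 <= x n)%E ->
  (forall n, ((K * b ^+ n)%:E <= x n)%E) -> (b%:E <= growth x)%E.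
Proof.
move=> b0 K0 x0 H; rewrite leNgt; apply/negP => lt_b.
have gx0 : (0 <= growth x)%E.
  apply: le_ereal_inf_tmp => _ [A [n0 _ n0A] <-].
  apply: (@le_trans _ _ (x n0 `^ n0%:R^-1)%E); first exact: poweR_ge0.
  by apply: ereal_sup_ubound; exists n0 => //; apply: n0A => /=.
pose g := fine (growth x).
have gE : growth x = g%:E by rewrite fineK// ge0_fin_numE// (lt_trans lt_b)// ltry.
have g0 : 0 <= g by apply: fine_ge0.
have gb : g < b by rewrite -lte_fin -gE.
pose c := (g + b) / 2; have c0 : 0 < c by rewrite /c; lra.
have gc : (growth x < c%:E)%E by rewrite gE lte_fin /c; lra.
have cb : c < b by rewrite /c; lra.
have [n0 n0P] := growth_lt c0 x0 gc.
(* With this constant, [2 c^n <= K b^n] eventually, which contradicts [K b^n <= x n <= c^n]. *)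
have K20 : 0 < 2 / K by rewrite divr_gt0.
have [n1 n1P] := expr_eventually_le c0 cb K20.
have := le_trans (H (maxn n0 n1)) (n0P _ (leq_maxl _ _)); rewrite lee_fin.
have := n1P _ (leq_maxr n0 n1); set n := maxn n0 n1; have := exprn_gt0 n c0.
rewrite mulrAC ler_pdivrMr// mulrC; lra.
Qed.

Lemma growth_recurrence (x : nat -> R) (al be K : R) n0 : (forall n, 0 <= x n) ->
  0 <= al -> al < be -> 0 < K ->
  (forall n, (n0 <= n)%N -> x n.+1 <= al * x n + K * be ^+ n) ->
  exists2 L, 0 < L & forall n, (n0 <= n)%N -> x n <= L * be ^+ n.
Proof.
move=> x0 al0 albe K0 H; have be0 : 0 < be by exact: le_lt_trans albe.
(* The first summand is the fixed point of the recurrence satisfied by [x n / be ^+ n]; the second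
   absorbs the value at [n0]. *)
pose L := K / (be - al) + x n0 / be ^+ n0.
have bal : 0 < be - al by rewrite subr_gt0.
have Kb : 0 < K / (be - al) by rewrite divr_gt0.
have xb : 0 <= x n0 / be ^+ n0 by rewrite divr_ge0// exprn_ge0// ltW.
exists L; first by rewrite ltr_pwDl.
elim=> [|n IH].
  rewrite leqn0 => /eqP n00; rewrite /L n00 !expr0 !mulr1 divr1; move: Kb; lra.
rewrite leq_eqVlt => /predU1P[<-|].
  rewrite /L mulrDl divfK ?gt_eqF ?exprn_gt0// lerDr mulr_ge0 ?(ltW Kb)//.
  by rewrite exprn_ge0// ltW.
rewrite ltnS => n0n; apply: le_trans (H n n0n) _; rewrite exprS mulrCA.
have bn : 0 < be ^+ n by rewrite exprn_gt0.
have L1 : K <= (be - al) * L.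
  rewrite /L mulrDr mulrCA mulfV ?gt_eqF// mulr1 lerDl mulr_ge0// ltW//.
have := ler_wpM2l al0 (IH n0n).
have := ler_wpM2r (ltW bn) L1.
rewrite mulrBl !mulrBl !mulrA; lra.
Qed.

End Growth.

(** * Leading moments *)

Section LeadingMoments.
Variables (R : realType) (d : nat).
Local Notation C := R[i].
Local Notation T := 'rV[int]_d.
Local Notation fseq := (fseq R d).

Lemma linf_mom r t (u : fseq r t) : l0 u ->
  linf (fun f : ('I_d -> C) -> C => \sum_(k \in [set: T]) f (zc k) *: u k).
Proof.
move=> /finsuppP[X [uX u0]]; apply: (@linf_fsum _ _ _ _ X) => [k|k f /u0 ->].
  exact: linf_eval.
by rewrite scaler0.
Qed.

Lemma affine_mom_seq r t (u : fseq r t) (al : C) (be : 'I_d -> C) s : l0 u ->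
  (forall s', (size s' < size s)%N -> mom s' u = 0) ->
  \sum_(k \in [set: T]) mon s (fun i => al * zc k i + be i) *: u k =
  al ^+ size s *: mom s u.
Proof. by move=> hu u0; rewrite (affine_mom _ _ (linf_mom hu)). Qed.

Lemma mom_nil r t (u : fseq r t) (X : seq T) : uniq X ->
  (forall k, k \notin X -> u k = 0) -> mom [::] u = \sum_(k <- X) u k.
Proof.
move=> uX u0; rewrite (momE _ uX u0); apply: eq_bigr => k _.
by rewrite /mon big_nil scale1r.
Qed.

(** For fixed [l] the argument is affine in [k], so the vanishing lower moments of [u] leave only
    the leading term, in which [l] no longer occurs. *)
Lemma dilated_conv_lead r t q (M : nat) (u : fseq r t) (a : fseq t q) s : l0 u -> l0 a ->
  (forall s', (size s' < size s)%N -> mom s' u = 0) ->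
  \sum_(k \in [set: T]) \sum_(l \in [set: T])
    mon s (zc (M%:Z *: k + l)) *: (u k *m a l) =
  M%:R ^+ size s *: (mom s u *m mom [::] a).
Proof.
move=> hu ha u_mom; have /finsuppP[X [uX u0]] := hu; have /finsuppP[Y [uY a0]] := ha.
rewrite (fsum2E (fun k l => mon s (zc (M%:Z *: k + l))) uX uY u0 a0) exchange_big.
rewrite (mom_nil uY a0) mulmx_sumr scaler_sumr; apply: eq_bigr => l _.
rewrite scalemxAl -(affine_mom_seq M%:R (zc l) hu u_mom).
rewrite (fsumE X)//; last by move=> k /u0 ->; rewrite scaler0.
rewrite mulmx_suml; apply: eq_bigr => k _; rewrite -scalemxAl; congr (mon s _ *: _).
by apply/funext => i; rewrite /zc !mxE intrD intrM.
Qed.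

Lemma mom_conv_lead r t q (y : fseq r t) (u : fseq t q) s : l0 y -> l0 u ->
  (forall s', (size s' < size s)%N -> mom s' u = 0) ->
  mom s (conv y u) = mom [::] y *m mom s u.
Proof.
move=> hy hu u_mom; have /finsuppP[X [uX y0]] := hy; have /finsuppP[Y [uY u0]] := hu.
apply: (etrans (fsum_conv _ hy hu)).
rewrite (fsum2E (fun k l => mon s (zc (k + l))) uX uY y0 u0).
rewrite (mom_nil uX y0) mulmx_suml; apply: eq_bigr => k _.
rewrite -[mom s u]scale1r -(expr1n _ (size s)).
rewrite -(affine_mom_seq 1 (zc k) hu u_mom).
rewrite (fsumE Y)//; last by move=> l /u0 ->; rewrite scaler0.
rewrite mulmx_sumr; apply: eq_bigr => l _; rewrite -scalemxAr; congr (mon s _ *: _).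
by apply/funext => i; rewrite /zc !mxE intrD mul1r addrC.
Qed.

Lemma mom_conv_nil r t q (y : fseq r t) (u : fseq t q) : l0 y -> l0 u ->
  mom [::] (conv y u) = mom [::] y *m mom [::] u.
Proof. by move=> hy hu; apply: mom_conv_lead. Qed.

Lemma mom_nil_delta r t (e : 'M[C]_(r, t)) : mom [::] (fun k : T => delta R k *: e) = e.
Proof.
rewrite (@mom_nil _ _ _ [:: 0])//; first by rewrite big_seq1 /delta eqxx scale1r.
by move=> k; rewrite inE /delta => /negPf ->; rewrite scale0r.
Qed.

Lemma mom_subdivision r M (a v : fseq r r) : l0 a -> l0 v ->
  mom [::] (subdivision M a v) = M%:R ^+ d *: (mom [::] v *m mom [::] a).
Proof.
move=> ha hv; have /finsuppP[X [uX v0]] := hv.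
have m0 r' t' (u : fseq r' t') : mom [::] u = \sum_(k \in [set: T]) u k.
  by apply: eq_fsum => k; rewrite /mon big_nil scale1r.
have hax x : finsupp (fun k => M%:R ^+ d *: (v x *m a (k - M%:Z *: x))).
  have /finsuppP[Z [_ a0]] : finsupp (fun k => a (k - M%:Z *: x)).
    apply: (finsupp_can (h' := fun z => z + M%:Z *: x) _ ha) => z /=.
    by rewrite subrK.
  by apply: (@seq_finsupp _ _ Z) => k /a0 ->; rewrite mulmx0 scaler0.
rewrite m0; transitivity (\sum_(k \in [set: T]) \sum_(x <- X)
    M%:R ^+ d *: (v x *m a (k - M%:Z *: x))).
  apply: eq_fsum => k; rewrite /subdivision (fsumE X)//; last first.
    by move=> x /v0 ->; rewrite mul0mx.
  by rewrite scaler_sumr.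
rewrite fsum_sum// (mom_nil uX v0) mulmx_suml scaler_sumr; apply: eq_bigr => x _.
apply: (etrans (fsum_shift _ (M%:Z *: x))); rewrite m0.
have hva : finsupp (fun k => v x *m a k).
  by have /finsuppP[Z [_ a0]] := ha; apply: (@seq_finsupp _ _ Z) => k /a0 ->; rewrite mulmx0.
rewrite (raddf_fsum (mulmx (v x)))//; apply: esym.
apply: (etrans (raddf_fsum (GRing.scale (M%:R ^+ d)) hva)).
by apply: eq_fsum => k; rewrite addrK.
Qed.

(** Each subdivision multiplies the symbol at 0 on the right by [M^d] times that of [a], and the
    left eigenvector passes through. *)
Lemma mom_cascade r M (a : fseq r r) (U : 'rV[C]_r) (lam : C) n : l0 a ->
  U *m mom [::] a = lam *: U ->
  U *m mom [::] (cascade M a n) = (M%:R ^+ d * lam) ^+ n *: U.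
Proof.
move=> ha Ua; elim: n => [|n IH].
  by rewrite expr0 scale1r /cascade /= /deltaI mom_nil_delta mulmx1.
rewrite /cascade iterS -/(cascade M a n) mom_subdivision//; last exact: l0_cascade.
by rewrite -scalemxAr mulmxA IH -scalemxAl Ua !scalerA exprSr mulrCA -!mulrA.
Qed.

(* The witness is the [n]-fold convolution power of [delta I - f y] applied to [e]:
   each factor multiplies [y * w] by [delta - y * f], whose symbol vanishes at 0. *)
Lemma test_sequence r (y : fseq 1 r) (f e : 'cV[C]_r) n : l0 y ->
  mom [::] y *m f = 1%:M -> mom [::] y *m e = 0 ->
  exists w : fseq r 1, Vspace n.+1 y w /\ mom [::] w = e.
Proof.
move=> hy yf ye; elim: n => [|n [w [/(VspaceP _ _ hy)[hw w0] we]]].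
  exists (fun k => delta R k *: e); rewrite mom_nil_delta; split=> //.
  have hw : l0 (fun k : T => delta R k *: e).
    by apply: (@seq_finsupp _ _ [:: 0]) => k; rewrite inE /delta => /negPf ->; rewrite scale0r.
  apply/(VspaceP _ _ hy); split=> // s; rewrite ltnS leqn0 => /eqP/size0nil ->.
  by rewrite mom_conv_nil// mom_nil_delta ye.
have hyw := l0_conv hy hw.
pose g : fseq r 1 := fun k => f *m conv y w k.
have hg : l0 g.
  have /finsuppP[X [_ X0]] := hyw.
  by apply: (@seq_finsupp _ _ X) => k /X0; rewrite /g => ->; rewrite mulmx0.
have momg s : mom s g = f *m mom s (conv y w).
  have /finsuppP[X [uX X0]] := hyw.
  rewrite (momE _ uX X0) mulmx_sumr (@momE _ _ _ _ _ _ X)//; last first.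
    by move=> k /X0; rewrite /g => ->; rewrite mulmx0.
  by apply: eq_bigr => k _; rewrite scalemxAr.
exists (fun k => w k - 1 *: g k); split; last first.
  by rewrite momB// we momg w0// mulmx0 scaler0 subr0.
apply/(VspaceP _ _ hy); split=> [|s]; first exact: l0B.
rewrite ltnS => sn; rewrite convB// momB; try exact: l0_conv.
rewrite (mom_conv_lead (u := g))//; last first.
  by move=> s' s's; rewrite momg w0 ?mulmx0// (leq_trans s's).
by rewrite momg mulmxA yf mul1mx scale1r subrr.
Qed.

(** The hypothesis is the matching condition at [omega = 0] in the single degree [size s]. It is not
    stated through [matching_filter] because it is applied to differences, whose symbol may vanish
    at 0. *)
Lemma matching_eigen r (M : nat) (a : fseq r r) (u : fseq 1 r) s : (0 < M)%N ->
  l0 a -> l0 u -> (forall s', (size s' < size s)%N -> mom s' u = 0) ->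
  \sum_(k \in [set: T]) \sum_(l \in [set: T])
    mon s (zc (M%:Z *: k + l)) *: (u k *m a l) = mom s u ->
  mom s u *m mom [::] a = M%:R ^- size s *: mom s u.
Proof.
move=> M0 ha hu u_mom; rewrite dilated_conv_lead// => {2}<-.
by rewrite scalerA mulVf ?scale1r// expf_neq0// pnatr_eq0 -lt0n.
Qed.

(** The condition at [omega = 0] is linear in the filter, hence passes from [v] and [y] to
    [v - c y], whose moments below degree [size s] vanish. *)
Lemma matching_sub_eigen r (M j j' : nat) (a : fseq r r) (y v : fseq 1 r) (c : C) s :
  (0 < M)%N -> l0 a -> l0 y -> l0 v ->
  matching_filter M a j y -> matching_filter M a j' v ->
  (size s < j)%N -> (size s < j')%N ->
  (forall s', (size s' < size s)%N -> mom s' v = c *: mom s' y) ->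
  (mom s v - c *: mom s y) *m mom [::] a =
  M%:R ^- size s *: (mom s v - c *: mom s y).
Proof.
move=> M0 ha hy hv my mv sj sj' vy.
have hu : l0 (fun k => v k - c *: y k) by exact: l0B.
rewrite -momB//; apply: matching_eigen => //.
  by move=> s' s's; rewrite momB// vy// subrr.
rewrite momB// -(matching_mom0 ha hy my sj) -(matching_mom0 ha hv mv sj').
have /finsuppP[X [uX y0]] := hy; have /finsuppP[Z [uZ v0]] := hv.
have /finsuppP[Y [uY a0]] := ha.
pose XZ := undup (X ++ Z).
have uXZ : uniq XZ by exact: undup_uniq.
have XZ0 k : k \notin XZ -> y k = 0 /\ v k = 0.
  by rewrite mem_undup mem_cat negb_or => /andP[/y0-> /v0->].
pose G k l := mon s (zc (M%:Z *: k + l)) : C.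
have E (x : fseq 1 r) (x0 : forall k, k \notin XZ -> x k = 0) :=
  fsum2E G uXZ uY x0 a0.
have u0 k : k \notin XZ -> v k - c *: y k = 0.
  by move=> /XZ0[-> ->]; rewrite scaler0 subrr.
have Ev := E v (fun k kXZ => (XZ0 k kXZ).2).
have Ey := E y (fun k kXZ => (XZ0 k kXZ).1).
apply: (etrans (E _ u0)); apply: esym; apply: (etrans (congr2 (fun p q => p - c *: q) Ev Ey)).
rewrite scaler_sumr -sumrB; apply: eq_bigr => k _.
rewrite scaler_sumr -sumrB; apply: eq_bigr => l _.
by rewrite mulmxBl scalerBr -scalemxAl !scalerA [c * _]mulrC.
Qed.

Lemma Vspace_jets r j n (y v : fseq 1 r) (w : fseq r 1) (c : C) : l0 y -> l0 v ->
  c != 0 -> (n <= j)%N -> (forall s, (size s < n)%N -> mom s v = c *: mom s y) ->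
  Vspace j v w -> Vspace n y w.
Proof.
move=> hy hv c0 nj vy /(VspaceP _ _ hv)[hw w0]; apply/(VspaceP _ _ hy); split=> // s sn.
have hu : l0 (fun k => v k - c *: y k) by exact: l0B.
have u0 s' : (size s' < n)%N -> mom s' (fun k => v k - c *: y k) = 0.
  by move=> s'n; rewrite momB// vy// subrr.
apply: (scalerI c0); rewrite scaler0.
(* With dilation 1 this is the [s]-moment of [(v - c y) * w], which therefore vanishes below degree
   [n]; so [v * w] and [c y * w] have equal moments there. *)
have := dilated_conv_lead 1 hu hw (fun s' s's => u0 s' (ltn_trans s's sn)).
rewrite u0// mul0mx scaler0; have := w0 s (leq_trans sn nj).
have /finsuppP[X [uX y0]] := hy; have /finsuppP[Z [uZ v0]] := hv.
have /finsuppP[Y [uY w0']] := hw.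
pose XZ := undup (X ++ Z).
have uXZ : uniq XZ by exact: undup_uniq.
have XZ0 k : k \notin XZ -> y k = 0 /\ v k = 0.
  by rewrite mem_undup mem_cat negb_or => /andP[/y0-> /v0->].
pose G k l := mon s (zc (k + l)) : C.
pose G1 k l := mon s (zc (1%:Z *: k + l)) : C.
have u0' k : k \notin XZ -> v k - c *: y k = 0.
  by move=> /XZ0[-> ->]; rewrite scaler0 subrr.
have E (x : fseq 1 r) : l0 x -> (forall k, k \notin XZ -> x k = 0) ->
    mom s (conv x w) = \sum_(k <- XZ) \sum_(l <- Y) G k l *: (x k *m w l).
  by move=> hx x0; apply: (etrans (fsum_conv _ hx hw)); exact: (fsum2E G uXZ uY x0 w0').
rewrite (E v hv (fun k kXZ => (XZ0 k kXZ).2)) (E y hy (fun k kXZ => (XZ0 k kXZ).1)).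
move=> vw /(etrans (esym (fsum2E G1 uXZ uY u0' w0'))) uw.
apply/eqP; rewrite -oppr_eq0 -[X in X == _]sub0r -[X in X - _ == _]vw -[X in _ == X]uw.
apply/eqP; rewrite scaler_sumr -sumrB; apply: eq_bigr => k _.
rewrite scaler_sumr -sumrB; apply: eq_bigr => l _.
by rewrite /G1 /G scale1r mulmxBl scalerBr -scalemxAl !scalerA [c * _]mulrC.
Qed.

End LeadingMoments.

(** * Lower bound for the growth *)

Section LowerBound.
Variables (R : realType) (d : nat).
Local Notation C := R[i].
Local Notation T := 'rV[int]_d.
Local Notation fseq := (fseq R d).

Definition in_box r t (N : nat) (u : fseq r t) : Prop :=
  forall k, u k != 0 -> forall i, (absz (k 0%R i) <= N)%N.

Definition box (N : nat) : seq T :=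
  [seq \row_i ((z i : int) - N%:Z) | z : {ffun 'I_d -> 'I_(N.*2.+1)}].

Lemma box_uniq N : uniq (box N).
Proof.
rewrite map_inj_uniq ?enum_uniq// => z z' /rowP E; apply/ffunP => i.
by apply/val_inj; have := E i; rewrite !mxE => /addIr [].
Qed.

Lemma size_box N : size (box N) = (N.*2.+1 ^ d)%N.
Proof. by rewrite size_map -cardE card_ffun !card_ord. Qed.

Lemma in_boxP r t N (u : fseq r t) : in_box N u -> forall k, k \notin box N -> u k = 0.
Proof.
move=> uN k; apply: contraNeq => /uN kN.
have lt i : (absz (k 0 i + N%:Z)%R < N.*2.+1)%N.
  by move: (k 0 i) (kN i) => m; lia.
apply/mapP; exists [ffun i => Ordinal (lt i)]; first by rewrite mem_enum.
apply/rowP => i; rewrite !mxE ffunE /=; move: (k 0 i) (kN i) => m; lia.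
Qed.

Lemma l0_in_box r t (u : fseq r t) : l0 u -> exists N, in_box N u.
Proof.
move=> /finsuppP[X [_ u0]].
exists (\max_(k <- X) \max_i absz (k 0%R i))%N => k uk i.
have kX : k \in X by apply: contraNT uk => /u0 ->.
by rewrite (leq_trans _ (leq_bigmax_seq _ kX isT))// (leq_bigmax i).
Qed.

Lemma in_box_conv r t q N N' (y : fseq r t) (u : fseq t q) :
  in_box N y -> in_box N' u -> in_box (N + N') (conv y u).
Proof.
move=> yN uN k; apply: contra_neqP => /existsNP[i /negP].
rewrite -ltnNge => ki; apply: fsum0 => z.
have [->|/yN zN] := eqVneq (y z) 0; first by rewrite mul0mx.
have [->|/uN kzN] := eqVneq (u (k - z)) 0; first by rewrite mulmx0.
exfalso; have := zN i; have := kzN i; rewrite !mxE.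
by move: ki; move: (k 0 i) (z 0 i) => m m'; lia.
Qed.

Lemma in_box_subdivision r N N' M (a v : fseq r r) :
  in_box N a -> in_box N' v -> in_box (M * N' + N) (subdivision M a v).
Proof.
move=> aN vN k; apply: contra_neqP => /existsNP[i /negP].
rewrite -ltnNge => ki; rewrite /subdivision fsum0 ?scaler0// => z.
have [->|/vN zN] := eqVneq (v z) 0; first by rewrite mul0mx.
have [->|/aN kzN] := eqVneq (a (k - M%:Z *: z)) 0; first by rewrite mulmx0.
exfalso; have := zN i; have := kzN i; rewrite !mxE => H1 H2.
have H3 : (absz (M%:Z * z 0 i)%R <= M * N')%N by rewrite abszM leq_mul2l H2 orbT.
by move: ki H1 H3; move: (k 0 i) (M%:Z * z 0 i) (M * N')%N => m m' m''; lia.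
Qed.

(** One step turns the radius into [M (N M^n - N) + N], which is at most [N M^(n+1) - N] because
    [M >= 2]. *)
Lemma in_box_cascade r N M (a : fseq r r) n : (1 < M)%N -> in_box N a ->
  in_box (N * M ^ n - N) (cascade M a n).
Proof.
move=> M1 aN; elim: n => [|n IH].
  move=> k; rewrite /cascade/= /deltaI /delta; case: (eqVneq k 0) => [->|_].
    by move=> _ i; rewrite mxE.
  by rewrite scale0r eqxx.
have := in_box_subdivision aN IH; rewrite -/(cascade M a n.+1).
move=> H k /H kH i; apply: leq_trans (kH i) _.
have : (1 <= M ^ n)%N by rewrite expn_gt0 (ltn_trans _ M1).
rewrite expnS; nia.
Qed.

Lemma normc_sum (I : Type) (X : seq I) (f : I -> C) :
  normc (\sum_(i <- X) f i) <= \sum_(i <- X) normc (f i).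
Proof.
elim: X => [|i X IH]; first by rewrite !big_nil ComplexField.Normc.normc0.
by rewrite !big_cons (le_trans (le_normcD _ _))// lerD2l.
Qed.

Lemma normc_nat n : normc (n%:R : C) = n%:R.
Proof.
have -> : (n%:R : C) = (n%:R : R)%:C%C by rewrite rmorph_nat.
by rewrite /= expr0n/= addr0 sqrtr_sqr ger0_norm.
Qed.

Lemma normcX (z : C) n : normc (z ^+ n) = normc z ^+ n.
Proof.
elim: n => [|n IH]; first by rewrite !expr0 ComplexField.Normc.normc1.
by rewrite !exprS ComplexField.Normc.normcM IH.
Qed.

Lemma normc_gt0 (z : C) : z != 0 -> 0 < normc z.
Proof.
move=> z0; rewrite lt_neqAle normc_ge0 andbT eq_sym; apply: contra z0 => /eqP.
by move/ComplexField.Normc.eq0_normc => ->.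
Qed.

Variables (r M : nat) (p : \bar R) (a : fseq r r).
Hypotheses (M_gt1 : (1 < M)%N) (p1 : (1%:E <= p)%E) (ha : l0 a).

(** The critical rate of degree [t]: the ratio of the recurrence on [Vspace t], and the growth
    forced by a left eigenvector for [M^-t]. *)
Definition level (t : nat) : R := M%:R `^ (dim_over d p - t%:R).

Lemma level_gt0 t : 0 < level t.
Proof. by rewrite powR_gt0// ltr0n (ltn_trans _ M_gt1). Qed.

Lemma le_level t t' : (t <= t')%N -> level t' <= level t.
Proof. by move=> tt'; apply: ler_powR; rewrite ?ler1n ?(ltnW M_gt1)// lerB// ler_nat. Qed.

Lemma levelE t : level t = M%:R `^ dim_over d p * M%:R ^- t.
Proof.
have M0 : 0 <= M%:R :> R by [].
rewrite /level powRD; last by rewrite pnatr_eq0 -lt0n (ltnW M_gt1) implybT.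
by rewrite powRN powR_mulrn.
Qed.

Lemma row_mul_normc (U : 'rV[C]_r) (F : fseq r 1) (X : seq T) (A : R) (N : nat) :
  l0 F -> uniq X -> (forall k, k \notin X -> F k = 0) -> (size X <= N)%N -> (0 < N)%N ->
  0 < A -> nrm p F <= A ->
  normc ((U *m mom [::] F) 0 0) <=
    (\sum_i normc (U 0 i)) * (2 * A * N%:R `^ (1 - inv_exp p)).
Proof.
move=> hF uX F0 XN N0 A0 FA; rewrite mxE mulr_suml.
apply: le_trans (normc_sum _ _) _; apply: ler_sum => i _.
rewrite ComplexField.Normc.normcM ler_wpM2l ?normc_ge0// (mom_nil uX F0) summxE.
apply: le_trans (normc_sum _ _) _.
apply: (sum_normc_le (u := fun k => F k i 0)) => //; first by move=> k /F0 ->; rewrite mxE.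
by rewrite (nrm1E p1 i hF) lee_fin (le_trans (nrm1_le_nrm p1 F i)).
Qed.

(** Applied to the sum of [A_n * w], the row [U] yields a constant times [M^((d - t) n)]. Hoelder on
    a box of [O(M^(d n))] points costs [M^(d (1 - 1/p) n)], and the quotient is [level t ^+ n]. *)
Lemma cascade_lower_bound t (U : 'rV[C]_r) (w : fseq r 1) : l0 w ->
  U *m mom [::] a = M%:R ^- t *: U -> (U *m mom [::] w) 0 0 != 0 ->
  exists2 K, 0 < K & forall n, K * level t ^+ n <= nrm p (conv (cascade M a n) w).
Proof.
move=> hw Ua Uw; have M0 : (0 < M)%N by exact: ltnW.
have MR : 0 < M%:R :> R by rewrite ltr0n.
have [Na aN] := l0_in_box ha; have [Nw wN] := l0_in_box hw.
pose B := (Na + Nw).+1.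
pose e := 1 - inv_exp p.
pose S := \sum_i normc (U 0 i).
have S0 : 0 < S.
  rewrite lt_neqAle sumr_ge0 ?andbT => [|i _]; last exact: normc_ge0.
  rewrite eq_sym; apply: contra Uw; rewrite psumr_eq0 => [/allP U0|i _]; last exact: normc_ge0.
  rewrite mxE big1// => i _; have := U0 i; rewrite mem_index_enum => /(_ isT)/eqP.
  by move=> /ComplexField.Normc.eq0_normc ->; rewrite mul0r.
pose c0 := normc ((U *m mom [::] w) 0 0).
have c00 : 0 < c0 by exact: normc_gt0.
(* Collects the norm of [U], the Hoelder factor 2, and the part of the box size independent of [n]:
   a box of radius [B M^n] has side at most [3 B M^n]. *)
pose D := S * (2 * (3 * B)%:R `^ (d%:R * e)).
have D0 : 0 < D by rewrite mulr_gt0// mulr_gt0// powR_gt0// ltr0n muln_gt0.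
exists (c0 / D); first by rewrite divr_gt0.
move=> n; apply/ler_addgt0Pr => ep ep0.
have hF : l0 (conv (cascade M a n) w) by apply: l0_conv => //; exact: l0_cascade.
set F := conv _ w in hF *.
pose Nn := (B * M ^ n)%N.
have FN : in_box Nn F.
  have := in_box_conv (in_box_cascade (n := n) M_gt1 aN) wN.
  move=> H k /H kH i; apply: leq_trans (kH i) _.
  have : (1 <= M ^ n)%N by rewrite expn_gt0 M0.
  rewrite /Nn /B; nia.
have Nn0 : (0 < Nn)%N by rewrite muln_gt0 expn_gt0 M0.
have A0 : 0 < nrm p F + ep by rewrite ltr_wpDl// nrm_ge0.
have szN : (size (box Nn) <= (3 * Nn) ^ d)%N.
  have mono x y k : (x <= y -> x ^ k <= y ^ k)%N.
    by case: k => [|k] xy; rewrite ?expn0// leq_exp2r.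
  by rewrite size_box; apply: mono; move: Nn0; lia.
have N0 : (0 < (3 * Nn) ^ d)%N by rewrite expn_gt0 muln_gt0 Nn0.
have FA : nrm p F <= nrm p F + ep by rewrite lerDl ltW.
have := @row_mul_normc U F (box Nn) _ _ hF (box_uniq Nn) (in_boxP FN) szN N0 A0 FA.
rewrite mom_conv_nil//; last exact: l0_cascade.
rewrite mulmxA (mom_cascade M n ha Ua) -scalemxAl mxE ComplexField.Normc.normcM -/c0.
rewrite normcX ComplexField.Normc.normcM normcX ComplexField.Normc.normcV normcX normc_nat.
(* The factor by which the Hoelder constant grows at each level. *)
pose Q := M%:R `^ (d%:R * e) : R; have Q0 : 0 < Q by rewrite powR_gt0.
have -> : ((3 * Nn) ^ d)%:R `^ (1 - inv_exp p) = (3 * B)%:R `^ (d%:R * e) * Q ^+ n.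
  rewrite -/e natrX -powR_mulrn ?ler0n// -powRrM /Nn mulnA natrM natrX.
  rewrite powRM ?ler0n ?exprn_ge0//; congr (_ * _).
  rewrite -powR_mulrn ?ler0n// -powRrM mulrC powRrM powR_mulrn ?powR_ge0//.
have -> : M%:R ^+ d * (M%:R ^+ t)^-1 = level t * Q.
  have MdQ : M%:R ^+ d = M%:R `^ dim_over d p * Q.
    rewrite -powRD; last by rewrite pnatr_eq0 -lt0n M0 implybT.
    rewrite -powR_mulrn ?ltW//; congr (_ `^ _).
    by rewrite /dim_over /e; ring.
  by rewrite levelE MdQ; ring.
rewrite exprMn -/S => H.
have Qn0 : 0 < Q ^+ n by rewrite exprn_gt0.
rewrite mulrAC ler_pdivrMr// -(ler_pM2r Qn0); move: H.
by congr (_ <= _); rewrite /D; ring.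
Qed.

Lemma rho_j_ge_level j t (y : fseq 1 r) (U : 'rV[C]_r) : l0 y -> (0 < j)%N ->
  mom [::] y != 0 -> U *m mom [::] a = M%:R ^- t *: U ->
  (forall c, U <> c *: mom [::] y) -> ((level t)%:E <= rho_j M p a j y)%E.
Proof.
move=> hy; case: j => // j _ Y0 Ua UY.
have [i Yi] : exists i, mom [::] y 0 i != 0.
  apply/existsP; apply: contraNT Y0; rewrite negb_exists => /forallP Y0.
  by apply/eqP/rowP => i; have := Y0 i; rewrite negbK mxE => /eqP.
(* A vector normalised by the symbol of [y]; then [e] below is a basis vector projected along [f]
   onto the kernel of that symbol. *)
pose f : 'cV[C]_r := (mom [::] y 0 i)^-1 *: delta_mx i 0.
have yf : mom [::] y *m f = 1%:M.
  rewrite -scalemxAr -colE; apply/matrixP => x z; rewrite !mxE !ord1 eqxx.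
  by rewrite mulVf.
(* Evaluating at [f] shows that this is the only possible proportionality factor; it fails at some
   entry [i'], so [U] does not kill [e]. *)
pose c := (U *m f) 0 0.
have Uf : U *m f = c%:M by apply/matrixP => x z; rewrite !ord1 !mxE eqxx mulr1n /c mxE.
have [i' Ui'] : exists i', U 0 i' - c * mom [::] y 0 i' != 0.
  apply: contrapT => /forallNP U0; apply: (UY c); apply/rowP => i'.
  have /negP := U0 i'; rewrite negbK subr_eq0 => /eqP ->.
  by rewrite mxE.
pose e : 'cV[C]_r := delta_mx i' 0 - mom [::] y 0 i' *: f.
have ye : mom [::] y *m e = 0.
  rewrite mulmxBr -scalemxAr yf -colE; apply/matrixP => x z.
  by rewrite !ord1 !mxE eqxx mulr1 subrr.
have Ue : (U *m e) 0 0 = U 0 i' - c * mom [::] y 0 i'.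
  by rewrite mulmxBr -scalemxAr Uf -colE !mxE eqxx mulr1n mulrC.
have [w [yw we]] := test_sequence j hy yf ye.
have hw : l0 w by case: yw.
have [|K K0 HK] := cascade_lower_bound hw Ua; first by rewrite we Ue.
have hF n : l0 (conv (cascade M a n) w) by apply: l0_conv => //; exact: l0_cascade.
apply: (@le_trans _ _ (growth (fun n => lp_norm p (conv (cascade M a n) w)))).
  apply: (growth_ge (level_gt0 t) K0) => n; rewrite (nrmE p1 (hF n)) lee_fin.
    exact: nrm_ge0.
  exact: HK.
by apply: ereal_sup_ubound; exists w.
Qed.

(** Induction on the degree. A moment of [v - c y] in degree [n] is an eigenvector for [M^-n], and
    the small growth rate forces it to be a multiple of the symbol of [y] at 0. That symbol has
    eigenvalue 1, so for [n > 0] the multiple is zero; in degree 0 the multiple is the constant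
    [c]. *)
Lemma matching_jets_proportional n j j' (y v : fseq 1 r) : l0 y -> l0 v ->
  matching_filter M a j y -> matching_filter M a j' v -> (n <= j)%N -> (n <= j')%N ->
  (forall t, (t < n)%N -> (rho_j M p a j y < (level t)%:E)%E) ->
  exists2 c, c != 0 & forall s, (size s < n)%N -> mom s v = c *: mom s y.
Proof.
move=> hy hv my mv; have M0 : (0 < M)%N by exact: ltnW.
have Y0 := mom_nil_neq0 my; have V0 := mom_nil_neq0 mv.
elim: n => [|n IH] nj nj' rho_lt; first by exists 1; rewrite ?oner_eq0.
have [|||c c0 vy] := IH; try exact: ltnW.
  by move=> t tn; apply: rho_lt; exact: ltnW.
(* In degree 0 no lower moments need to agree, so any [c'] is allowed; it is used with [c' = 0]. *)
have eigen c' : n = 0%N \/ c' = c -> forall s, size s = n ->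
    (mom s v - c' *: mom s y) *m mom [::] a = M%:R ^- n *: (mom s v - c' *: mom s y).
  move=> n0c s sn; rewrite -sn; apply: (matching_sub_eigen M0 ha hy hv my mv); rewrite ?sn//.
  by move=> s' s'n; case: n0c => [n0|->]; [rewrite n0 in s'n | exact: vy].
have level_contra s c' : size s = n -> n = 0%N \/ c' = c ->
    exists c'', mom s v - c' *: mom s y = c'' *: mom [::] y.
  move=> sn n0c; apply: contrapT => /forallNP U.
  have := @rho_j_ge_level j n y _ hy (leq_ltn_trans (leq0n _) nj) Y0 (eigen c' n0c s sn) U.
  by apply/negP; rewrite -ltNge rho_lt.
have [n0|n_gt0] := posnP n.
  have [c' vc'] := level_contra [::] 0 (esym n0) (or_introl n0).
  rewrite scale0r subr0 in vc'.
  exists c'; last by move=> s; rewrite n0 ltnS leqn0 => /eqP/size0nil ->.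
  by apply: contraNneq V0 => c'0; rewrite vc' c'0 scale0r.
exists c => // s; rewrite ltnS leq_eqVlt => /predU1P[sn|]; last exact: vy.
have [c' U] := level_contra s c sn (or_intror erefl).
have E := eigen c (or_intror erefl) s sn.
apply/eqP; rewrite -subr_eq0 U scaler_eq0; apply/orP; left.
have yA : mom [::] y *m mom [::] a = mom [::] y.
  have j0 : (size ([::] : seq 'I_d) < j)%N by exact: leq_ltn_trans nj.
  have := matching_eigen (s := [::]) M0 ha hy _ (matching_mom0 ha hy my j0).
  by rewrite expr0 invr1 scale1r; apply.
move: E; rewrite U -scalemxAl yA scalerA => /eqP.
rewrite -subr_eq0 -scalerBl scaler_eq0 (negPf Y0) orbF -{1}[c']mul1r -mulrBl.
rewrite mulf_eq0 => /orP[|//]; rewrite subr_eq0 eq_sym invr_eq1.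
have -> : (M%:R : C) ^+ n = (M ^ n)%:R by rewrite natrX.
by rewrite pnatr_eq1 => /eqP Mn; have := ltn_exp2l 0 n M_gt1; rewrite Mn expn0 ltnn n_gt0.
Qed.

End LowerBound.

(** * Upper bound for the growth *)

Section UpperBound.
Variables (R : realType) (d r M : nat) (p : \bar R).
Local Notation C := R[i].
Local Notation T := 'rV[int]_d.
Variable a : fseq R d r r.
Hypotheses (M_gt1 : (1 < M)%N) (p1 : (1%:E <= p)%E) (ha : l0 a).
Local Notation level := (level d M p).

Definition cascade_norm (w : fseq R d r 1) (n : nat) : \bar R :=
  lp_norm p (conv (cascade M a n) w).

Lemma cascade_normE w n : l0 w ->
  cascade_norm w n = (nrm p (conv (cascade M a n) w))%:E.
Proof. by move=> hw; apply: nrmE => //; apply: l0_conv => //; exact: l0_cascade. Qed.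

Lemma cascade_norm_ge0 w n : l0 w -> (0 <= cascade_norm w n)%E.
Proof. by move=> hw; rewrite cascade_normE// lee_fin; exact: nrm_ge0. Qed.

(* Descending induction on [n]: modulo V_{n+1}, each [trans g w] equals [M^-n w], so the
   norms of the cascade satisfy a recurrence with ratio [level n]. *)
Lemma growth_le_level n j (y : fseq R d 1 r) (w : fseq R d r 1) (b : R) : l0 y ->
  matching_filter M a j y -> (n <= j)%N -> Vspace n y w ->
  (rho_j M p a j y < b%:E)%E -> n = j \/ level n < b ->
  (growth (cascade_norm w) <= b%:E)%E.
Proof.
move=> hy my nj yw rb; have M0 : (0 < M)%N by exact: ltnW.
move: {2}(j - n)%N (erefl (j - n)%N) => m; elim: m n nj w yw => [|m IH] n nj w yw jn lb.
  (* In the base case [w] belongs to the family whose supremum is [rho_j]. *)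
  have {}nj : n = j by apply/eqP; rewrite eqn_leq nj -subn_eq0 jn eqxx.
  apply: le_trans (ltW rb); apply: ereal_sup_ubound; exists w => //.
  by rewrite -nj.
have nj' : (n < j)%N by rewrite -subn_gt0 jn.
have {}lb : level n < b by case: lb => [E|//]; rewrite E ltnn in nj'.
have b0 : 0 < b := lt_trans (level_gt0 d p M_gt1 n) lb.
have hw : l0 w by case: yw.
pose v z k := trans M a (@coset_rep d M z) w k - M%:R ^- n *: w k.
have yv z : Vspace n.+1 y (v z) by exact: Vspace_trans my nj' yw.
have hv z : l0 (v z) by case: (yv z).
have lb' : level n.+1 < b by apply: le_lt_trans lb; exact: le_level.
apply/lee_addgt0Pr => e e0; rewrite -EFinD; pose c := b + e.
have bc : b < c by rewrite /c ltrDl.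
have c0 : 0 < c by exact: lt_trans bc.
(* Each remainder has growth at most [b], hence is eventually bounded by the powers of the larger
   [c]. *)
have /choice[N HN] z : exists n0, forall k, (n0 <= k)%N ->
    (cascade_norm (v z) k <= (c ^+ k)%:E)%E.
  apply: growth_lt => // [k|]; first exact: cascade_norm_ge0.
  apply: le_lt_trans (IH n.+1 nj' (v z) (yv z) _ _) _; last by rewrite lte_fin.
    by rewrite subnS jn.
  by right.
pose n0 := (\max_z N z)%N; pose x k := nrm p (conv (cascade M a k) w).
have x0 k : 0 <= x k by exact: nrm_ge0.
pose K := M%:R `^ dim_over d p * #|{ffun 'I_d -> 'I_M}|%:R : R.
have K0 : 0 < K.
  rewrite mulr_gt0 ?powR_gt0 ?ltr0n// card_ffun !card_ord expn_gt0 M0//.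
have l0F k (u : fseq R d r 1) : l0 u -> l0 (conv (cascade M a k) u).
  by move=> hu; apply: l0_conv => //; exact: l0_cascade.
have xS k : (n0 <= k)%N -> x k.+1 <= level n * x k + K * c ^+ k.
  move=> n0k.
  have nMn : normc (M%:R ^- n : C) = M%:R ^- n.
    by rewrite ComplexField.Normc.normcV normcX normc_nat.
  (* The exact coset identity behind the recurrence for [x]. *)
  have step l z : conv (cascade M a k.+1) w (M%:Z *: l + coset_rep z) =
      M%:R ^- n *: conv (cascade M a k) w l + conv (cascade M a k) (v z) l.
    rewrite cascade_trans// convB; last exact: l0_cascade.
    by rewrite addrC subrK.
  have nM0 : 0 < normc (M%:R ^- n : C).
    by rewrite nMn invr_gt0 exprn_gt0// ltr0n.
  have := nrm_coset p1 M0 nM0 (l0F _ _ hw) (l0F _ _ hw) (fun z => l0F k _ (hv z)) step.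
  move=> /le_trans; apply; rewrite nMn mulrDr mulrA -levelE// lerD2l /K -mulrA.
  rewrite ler_pM2l ?powR_gt0 ?ltr0n// mulr_natl -sumr_const; apply: ler_sum => z _.
  have := HN z k; rewrite cascade_normE// lee_fin; apply.
  by apply: leq_trans n0k; exact: leq_bigmax.
have [L L0 HL] := growth_recurrence x0 (ltW (level_gt0 d p M_gt1 n)) (lt_trans lb bc) K0 xS.
apply: (growth_le c0 L0 (n0 := n0)) => [k|k n0k]; first exact: cascade_norm_ge0.
by rewrite cascade_normE// lee_fin; exact: HL.
Qed.

Lemma rho_j_le j k0 (y v : fseq R d 1 r) : l0 y -> l0 v ->
  matching_filter M a j y -> matching_filter M a k0 v ->
  ((level k0)%:E <= rho_j M p a j y)%E ->
  (rho_j M p a k0 v <= rho_j M p a j y)%E.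
Proof.
move=> hy hv my mv; have M0 : (0 < M)%N by exact: ltnW.
case E : (rho_j M p a j y) => [s| |] lk; [|exact: leey|by rewrite leeNy_eq in lk].
rewrite lee_fin in lk.
(* Such a degree exists because [k0] is one; minimality makes [rho_j] smaller than every level below
   [t]. *)
have [t lt tmin] := ex_minnP (ex_intro (fun t => level t <= s) k0 lk).
pose n := minn t j.
have nj : (n <= j)%N by exact: geq_minr.
have nk : (n <= k0)%N by rewrite (leq_trans (geq_minl _ _))// tmin.
have [t' t'n|c c0 vy] := matching_jets_proportional M_gt1 p1 ha hy hv my mv nj nk.
  rewrite E lte_fin ltNge; apply/negP => /tmin.
  by rewrite leqNgt (leq_trans t'n)// geq_minl.
apply: ge_ereal_sup => _ [w vw <-].
have yw : Vspace n y w by exact: Vspace_jets vy vw.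
apply/lee_addgt0Pr => e e0; rewrite -EFinD.
apply: (growth_le_level hy my nj yw); first by rewrite E lte_fin ltrDl.
(* If [t < j] then [n = t] and its level is at most [s]; otherwise [n = j]. *)
rewrite /n /minn; case: ltnP => _; last by left.
by right; rewrite (le_lt_trans lt)// ltrDl.
Qed.

Lemma d_overE : d_over d p = (dim_over d p)%:E.
Proof.
by rewrite /d_over /dim_over; case: p p1 => [q||] //= _; rewrite mulr0.
Qed.

(** Exponentiates the bound on [sm]. A nonpositive [rho] would have logarithm [-oo] and make [sm]
    infinite, contrary to that bound. *)
Lemma level_le_rho k : (sm M p a <= k%:R%:E)%E -> ((level k)%:E <= rho M p a)%E.
Proof.
have lnM : 0 < ln M%:R :> R by rewrite ln_gt0// ltr1n.
have sm_pinfty x : (x <= 0)%E -> (d_over d p - logM M x)%E = +oo%E.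
  by move=> x0; rewrite /logM le0_lneNy// gt0_mulNye ?lte_fin ?invr_gt0// d_overE.
rewrite /sm; case: (rho M p a) => [x| |]; last by rewrite sm_pinfty ?leNye// leye_eq.
  have [x0|x0] := leP x 0; first by rewrite sm_pinfty ?lee_fin// leye_eq.
  rewrite /logM lne_EFin// d_overE lee_fin lee_fin => H.
  rewrite -ler_ln ?posrE ?level_gt0// ln_powR -ler_pdivlMr//.
  by move: H; lra.
by rewrite leey.
Qed.

End UpperBound.

(** * Independence of the growth rate from the matching filter *)

Theorem theorem2p3 (R : realType) (d : nat) (hd : (0 < d)%N)
  (M : nat) (hM : (1 < M)%N) (r : nat) (hr : (0 < r)%N)
  (p : \bar R) (hp : (1%:E <= p)%E)
  (a : fseq R d r r) (ha : l0 a)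
  (k0 : nat)
  (hsm : (sm M p a <= k0%:R%:E)%E) (hsr : (k0%:R%:E <= sr M a)%E)
  (v : fseq R d 1 r) (hv : l0 v) (hmatch : matching_filter M a k0 v) :
  rho M p a = rho_j M p a k0 v /\
  sm M p a = (d_over d p - logM M (rho_j M p a k0 v))%E.
Proof.
suff E : rho M p a = rho_j M p a k0 v by rewrite -E.
apply/eqP; rewrite eq_le; apply/andP; split.
  (* The pair [(k0, v)] is itself admissible in the infimum. *)
  by apply: ereal_inf_lbound; exists k0, v.
apply: le_ereal_inf_tmp => _ [j [y [jsr hy my ->]]].
apply: rho_j_le => //; apply: le_trans (level_le_rho hM hp hsm) _.
by apply: ereal_inf_lbound; exists j, y.
Qed.
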